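(* Let $d\ge2$, $s\in\mathbb N$, $\beta>-d-s$, and $\lambda_0,\dots,\lambda_{s-1}>0$. The polynomials $\mathsf S_{m,\ell}^{n,(\beta,-s)}$, $n\in\mathbb N_0$, $0\le m\le n$, $1\le\ell\le\dim\mathcal H_m^d$, are mutually orthogonal with respect to $\langle\cdot,\cdot\rangle_{\beta,-s}$, i.e. $\langle \mathsf S_{m,\ell}^{n,(\beta,-s)},\mathsf S_{m',\ell'}^{n',(\beta,-s)}\rangle_{\beta,-s}=0$ unless $(n,m,\ell)=(n',m',\ell')$; and for every $\ell$, $$\mathsf h_{m,n}^{(\beta,-s)}:=\langle \mathsf S_{m,\ell}^{n,(\beta,-s)},\mathsf S_{m,\ell}^{n,(\beta,-s)}\rangle_{\beta,-s}=\begin{cases}2^{2(n-m)}\lambda_{n-m},&0\le n-m\le s-1,\\[2pt] 2^{\,s-\beta-2m-d}\,\widehat h_{n-m-s}^{(s+2m+\beta+d-1,0)},& n-m\ge s.\end{cases}$$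
   Context: The conic surface is $\mathbb V_0^{d+1}=\{(x,t)\in\mathbb R^d\times\mathbb R:\|x\|=t,\ 0\le t\le1\}$; its points are written $(x,t)=(t\xi,t)$, $\xi\in\mathbb S^{d-1}$. $\mathrm d\mathsf m$ is its surface measure, with $\int_{\mathbb V_0^{d+1}}f\,\mathrm d\mathsf m=\int_0^1t^{d-1}\int_{\mathbb S^{d-1}}f(t\xi,t)\,\mathrm d\sigma(\xi)\,\mathrm dt$; $\sigma$ is surface measure on $\mathbb S^{d-1}$ and $\omega_d=2\pi^{d/2}/\Gamma(d/2)$. $\mathcal H_m^d$ is the space of spherical harmonics of degree $m$ on $\mathbb S^{d-1}$ and $\{Y_\ell^m:1\le\ell\le\dim\mathcal H_m^d\}$ an orthonormal basis for $\frac1{\omega_d}\int_{\mathbb S^{d-1}}fg\,\mathrm d\sigma$; $Y_\ell^m$ also denotes its extension to a homogeneous harmonic polynomial on $\mathbb R^d$ (so $Y_\ell^m(t\xi)=t^mY_\ell^m(\xi)$). Pochhammer $(a)_k=a(a+1)\cdots(a+k-1)$. Jacobi polynomials for real parameters: $P_n^{(\alpha,\beta)}(u)=\sum_{k=0}^n\frac{(\alpha+k+1)_{n-k}(-n)_k(n+\alpha+\beta+1)_k}{n!\,k!}(\frac{1-u}{2})^k$. $A_n^{(\alpha,\beta)}=2^n/(n+\alpha+\beta+1)_n$, $\widehat P_n^{(\alpha,\beta)}=A_n^{(\alpha,\beta)}P_n^{(\alpha,\beta)}$, and for $\alpha,\beta>-1$, $\widehat h_n^{(\alpha,\beta)}=\int_{-1}^1[\widehat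 P_n^{(\alpha,\beta)}(u)]^2(1-u)^\alpha(1+u)^\beta\,\mathrm du$. For $\alpha>-1-s$: $J_n^{(\alpha,-s)}(u)=\frac{(u+1)^n}{n!}$ if $0\le n\le s-1$, and $J_n^{(\alpha,-s)}(u)=\int_{-1}^u\frac{(u-w)^{s-1}}{(s-1)!}\widehat P_{n-s}^{(\alpha+s,0)}(w)\,\mathrm dw$ if $n\ge s$. Sobolev orthogonal polynomials: $\mathsf S_{m,\ell}^{n,(\beta,-s)}(x,t)=J_{n-m}^{(2m+\beta+d-1,-s)}(1-2t)\,Y_\ell^m(x)$, a polynomial in $(x,t)\in\mathbb R^{d+1}$. Sobolev inner product (for functions $f,g$ of $(x,t)\in\mathbb R^{d+1}$ for which it is finite, e.g. polynomials), with $\partial_t=\partial/\partial t$ the partial derivative in the last variable with $x$ held fixed: $\langle f,g\rangle_{\beta,-s}=\frac1{\omega_d}\int_{\mathbb V_0^{d+1}}\partial_t^sf(x,t)\,\partial_t^sg(x,t)\,t^{\beta+s}\,\mathrm d\mathsf m(x,t)+\sum_{k=0}^{s-1}\frac{\lambda_k}{\omega_d}\int_{\mathbb S^{d-1}}\partial_t^kf(\xi,1)\,\partial_t^kg(\xi,1)\,\mathrm d\sigma(\xi)$. *)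

(* Defs.v *)
From HB Require Import structures.
From mathcomp Require Import all_boot all_order all_algebra.
From mathcomp Require Import all_classical all_reals all_analysis.
From mathcomp Require mpoly.
Set Implicit Arguments. Unset Strict Implicit. Unset Printing Implicit Defensive.
Import Order.TTheory GRing.Theory Num.Theory.
Local Open Scope classical_set_scope.
Local Open Scope ring_scope.

Section Defs.
Variable R : realType.

Definition poch (a : R) (k : nat) : R := \prod_(i < k) (a + i%:R).

Definition jacobiP (al be : R) (n : nat) (u : R) : R :=
  \sum_(k < n.+1)
    (poch (al + k%:R + 1) (n - k) * poch (- n%:R) k * poch (n%:R + al + be + 1) k
      / (n`!%:R * k`!%:R)) * ((1 - u) / 2) ^+ k.

Definition jacA (al be : R) (n : nat) : R := 2 ^+ n / poch (n%:R + al + be + 1) n.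

Definition jacobiPhat (al be : R) (n : nat) (u : R) : R :=
  jacA al be n * jacobiP al be n u.

Definition jac_hhat (al be : R) (n : nat) : R :=
  Rintegral lebesgue_measure `[-1, 1]
    (fun u => (jacobiPhat al be n u) ^+ 2 * powR (1 - u) al * powR (1 + u) be).

Definition oint (a b : R) (f : R -> R) : R :=
  if a <= b then Rintegral lebesgue_measure `[a, b] f
  else - Rintegral lebesgue_measure `[b, a] f.

Definition jacJ (al : R) (s n : nat) (u : R) : R :=
  if (n < s)%N then (u + 1) ^+ n / n`!%:R
  else oint (-1) u (fun w => (u - w) ^+ s.-1 / (s.-1)`!%:R
                              * jacobiPhat (al + s%:R) 0 (n - s) w).

Definition enorm (d : nat) (x : 'rV[R]_d) : R := Num.sqrt (\sum_i x ord0 i ^+ 2).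

(* Lebesgue integral on R^n, defined as an iterated integral (Fubini) *)
Fixpoint iint (n : nat) (F : seq R -> R) : R :=
  match n with
  | 0%N => F [::]
  | n'.+1 => Rintegral lebesgue_measure setT (fun y => iint n' (fun s => F (y :: s)))
  end.

Definition lebint (d : nat) (g : 'rV[R]_d -> R) : R :=
  iint d (fun s => g (\row_i nth 0 s i)).

(* surface measure integral on S^{d-1}:  int_S g dsigma = d * int_{|x|<=1} g(x/|x|) dx *)
Definition sphere_int (d : nat) (g : 'rV[R]_d -> R) : R :=
  d%:R * lebint (fun x => (if enorm x <= 1 then 1 else 0) * g ((enorm x)^-1 *: x)).

(* Gamma(k/2) *)
Fixpoint gamma_half (k : nat) : R :=
  match k with
  | 0%N => 0 (* unused *)
  | 1%N => Num.sqrt pi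
  | 2%N => 1
  | (k'.+2) as k0 => (k'%:R / 2) * gamma_half k'
  end.

Definition omega (d : nat) : R := 2 * powR pi (d%:R / 2) / gamma_half d.

Definition cone_int (d : nat) (F : 'rV[R]_d -> R -> R) : R :=
  Rintegral lebesgue_measure `[0, 1]
    (fun t => t ^+ d.-1 * sphere_int (fun xi => F (t *: xi) t)).

Definition dtn (d k : nat) (f : 'rV[R]_d -> R -> R) (x : 'rV[R]_d) (t : R) : R :=
  derive1n k (f x) t.

Definition sob_ip (d : nat) (beta : R) (s : nat) (lam : nat -> R)
    (f g : 'rV[R]_d -> R -> R) : R :=
  (omega d)^-1 * cone_int (fun x t => dtn s f x t * dtn s g x t * powR t (beta + s%:R))
  + \sum_(k < s) lam k / omega d * sphere_int (fun xi => dtn k f xi 1 * dtn k g xi 1).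

Definition peval (d : nat) (p : mpoly.mpoly d R) (x : 'rV[R]_d) : R :=
  mpoly.meval (fun i => x ord0 i) p.

Definition homog_harmonic (d m : nat) (p : mpoly.mpoly d R) : Prop :=
  all (fun mon : mpoly.multinom d => mpoly.mdeg mon == m) (mpoly.msupp p) /\
  \sum_(i < d) mpoly.mderiv i (mpoly.mderiv i p) = 0.

Definition on_sphere (d : nat) (x : 'rV[R]_d) : Prop := enorm x = 1.

Definition sph_harm_ONB (d : nat) (N : nat -> nat) (Y : nat -> nat -> mpoly.mpoly d R) : Prop :=
  forall m : nat,
    (forall l, (1 <= l <= N m)%N -> homog_harmonic m (Y m l)) /\
    (forall l l', (1 <= l <= N m)%N -> (1 <= l' <= N m)%N ->
       (omega d)^-1 * sphere_int (fun xi => peval (Y m l) xi * peval (Y m l') xi)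
       = (l == l')%:R) /\
    (forall p, homog_harmonic m p ->
       exists c : nat -> R, forall xi, on_sphere xi ->
         peval p xi = \sum_(1 <= l < (N m).+1) c l * peval (Y m l) xi).

Definition sobS (d : nat) (Y : nat -> nat -> mpoly.mpoly d R) (beta : R) (s n m l : nat)
    : 'rV[R]_d -> R -> R :=
  fun x t => jacJ (2 * m%:R + beta + d%:R - 1) s (n - m) (1 - 2 * t) * peval (Y m l) x.

Definition sob_h (d : nat) (beta : R) (s : nat) (lam : nat -> R) (m n : nat) : R :=
  if (n - m < s)%N then 2 ^+ (2 * (n - m)) * lam (n - m)%N
  else powR 2 (s%:R - beta - 2 * m%:R - d%:R)
       * jac_hhat (s%:R + 2 * m%:R + beta + d%:R - 1) 0 (n - m - s).

End Defs.

(* Main.v *)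
(* Writing d_t^s S^n_{m,l} = (-2)^s (J^(s))(1 - 2t) Y_l^m(x), homogeneity of the
   harmonics factors every term of the inner product into a radial part and the
   spherical integral of Y_l^m Y_l'^m'.

   Spherical part. Iterating one-dimensional Beta integrals gives all moments of
   the unit ball, and with them I(d_i f) = (k + d + 1) I(x_i f) for f homogeneous
   of degree k, where I is the integral over the ball. For homogeneous harmonic p,
   q of degrees k, l this yields
     sum_i I(d_i p d_i q) = (k + l + d) l I(pq) = (k + l + d) k I(pq),
   so I(pq) = 0 if k <> l; the integral over the sphere is a multiple of I(pq).

   Radial part. J is the polynomial Q with Q^(s) = P-hat_{n-s} and with vanishing
   Taylor coefficients of order < s at -1 (resp. (u+1)^n/n! if n < s), so the
   boundary terms only see n - m < s and the integral over the cone only sees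
   n - m >= s, where it reduces to the orthogonality of the Jacobi polynomials for
   the weight t^(al) on [0, 1]. *)

Require Import Defs.
From HB Require Import structures.
From mathcomp Require Import all_boot all_order all_algebra.
From mathcomp Require Import all_classical all_reals all_analysis.
From mathcomp Require Import measurable_realfun.
From mathcomp Require mpoly.
From mathcomp Require Import ring lra zify.
Import (canonicals, coercions) mpoly.
Import Order.TTheory GRing.Theory Num.Theory.
Import numFieldNormedType.Exports.
Local Open Scope classical_set_scope.
Local Open Scope ring_scope.

Set Implicit Arguments. Unset Strict Implicit. Unset Printing Implicit Defensive.

(** The integral over R^d is an iterated real-valued integral, so additivity, scaling and exchange
    of integrals each need integrability at every level. All integrands here are jointly measurable
    and bounded by a constant times the indicator of the unit cube. This class is stable under
    freezing the first coordinate, and every induction on the dimension runs inside it. Only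
    polynomials are integrated over the ball. The divergence theorem is therefore an identity
    between moments, checked on monomials, where the iterated integral is a product of Beta
    integrals. No boundary integral appears. In the radial part the weights [t^(d-1)], [t^m] from
    each harmonic, and [t^(beta+s)] multiply to [t^al] with [al = s + 2m + beta + d - 1]. The bound
    on [beta] gives [al > -1]. The constant in the norm arises from [2^(2s)], produced by the two
    chain-rule factors [(-2)^s], divided by [2^(al+1)], produced by the substitution [u = 1 - 2t] in
    the Jacobi norm. *)

(** * Affine substitutions in one-dimensional Lebesgue integrals *)

Section affine_change_of_variable.
Context {R : realType}.
Implicit Types (a b c : R).
Local Notation mu := (@lebesgue_measure R).

Lemma measurable_affine a b :
  measurable_fun [set: R] (fun x : measurableTypeR R => a * x + b : measurableTypeR R).
Proof. by apply: measurable_funD => //; exact: measurable_funM. Qed.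

(** Lebesgue measure is determined by its values on the intervals []l, r]], so comparing lengths
    there suffices. For negative [a] the preimage is closed at the other end, which its length does
    not see. *)
Lemma lebesgue_measure_affine a b (A : set R) : a != 0 -> measurable A ->
  (mu A = `|a|%:E *
    pushforward mu (fun x : measurableTypeR R => a * x + b : measurableTypeR R)%R A)%E.
Proof.
move=> a0 mA.
pose f := fun x : measurableTypeR R => a * x + b : measurableTypeR R.
have na0 : 0 <= `|a| by [].
pose nu : {measure set (measurableTypeR R) -> \bar R} :=
  mscale (NngNum na0) (pushforward mu f).
rewrite -[RHS]/(nu (measurable_affine a b) A).
apply: (@lebesgue_measure_unique _ (nu _)) => // _ [[l r]] _ <-.
rewrite -[nu _ _]/(`|a|%:E * mu (f @^-1` `]l, r]))%E.
have -> : f @^-1` `]l, r] = if 0 < a then `](l - b) / a, (r - b) / a]%classic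
    else `[(r - b) / a, (l - b) / a[%classic.
  apply/seteqP; case: (ltP 0 a) => sa; split => x /=; rewrite !in_itv/= /f.
  - by rewrite ltr_pdivrMr // ler_pdivlMr // ltrBlDr lerBrDr mulrC.
  - by rewrite ltr_pdivrMr // ler_pdivlMr // ltrBlDr lerBrDr mulrC.
  - have an : a < 0 by rewrite lt_neqAle a0.
    by rewrite ltr_ndivlMr // ler_ndivrMr // ltrBlDr lerBrDr mulrC andbC.
  - have an : a < 0 by rewrite lt_neqAle a0.
    by rewrite ltr_ndivlMr // ler_ndivrMr // ltrBlDr lerBrDr mulrC andbC.
rewrite lebesgue_measure_itv/= lte_fin.
case: (ltP 0 a) => sa; rewrite lebesgue_measure_itv/= lte_fin.
  rewrite ltr_pM2r ?invr_gt0// ltrD2r; case: ifP => _; last by rewrite mule0.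
  by rewrite -!EFinD -EFinM gtr0_norm//; congr EFin; field.
have an : a < 0 by rewrite lt_neqAle a0.
rewrite ltr_nM2r ?invr_lt0// ltrD2r; case: ifP => _; last by rewrite mule0.
by rewrite -!EFinD -EFinM ltr0_norm//; congr EFin; field.
Qed.

Lemma ge0_integral_affine a b (f : R -> \bar R) (D : set R) : a != 0 ->
  measurable D -> measurable_fun D f -> (forall x, D x -> 0 <= f x)%E ->
  (\int[mu]_(x in D) f x = `|a|%:E * \int[mu]_(x in (fun x => a * x + b)%R @^-1` D) f (a * x +
      b)%R)%E.
Proof.
move=> a0 mD mf f0.
pose g := fun x : measurableTypeR R => a * x + b : measurableTypeR R.
have na0 : 0 <= `|a| by [].
pose nu : {measure set (measurableTypeR R) -> \bar R} :=
  mscale (NngNum na0) (pushforward mu g).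
rewrite (eq_measure_integral (nu (measurable_affine a b))); last first.
  by move=> A mA _; move: (lebesgue_measure_affine b a0 mA).
rewrite ge0_integral_mscale//= ge0_integral_pushforward//.
  exact: measurable_affine.
by move=> y; rewrite inE; exact: f0.
Qed.

Lemma ge0_integral_scale c (f : R -> \bar R) : c != 0 ->
  measurable_fun setT f -> (forall x, 0 <= f x)%E ->
  (\int[mu]_x f (c * x)%R = `|c|^-1%:E * \int[mu]_x f x)%E.
Proof.
move=> c0 mf f0; rewrite (@ge0_integral_affine c 0 f)// preimage_setT muleA -EFinM.
rewrite mulVf ?normr_eq0// mul1e.
by apply: eq_integral => x _; rewrite addr0.
Qed.

(** Integrability makes the positive and negative parts finite, so that the factor distributes over
    their difference and passes through [fine]. *)
Lemma Rintegral_scale c (f : R -> R) : c != 0 ->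
  mu.-integrable setT (EFin \o f) ->
  (\int[mu]_x f (c * x) = `|c|^-1 * \int[mu]_x f x)%R.
Proof.
move=> c0 intf; rewrite /Rintegral.
have mf : measurable_fun setT (EFin \o f) by exact: measurable_int intf.
have ip := ge0_integral_scale c0 (measurable_funepos mf) (funepos_ge0 _).
have iN := ge0_integral_scale c0 (measurable_funeneg mf) (funeneg_ge0 _).
transitivity (fine (`|c|^-1%:E * \int[mu]_x (EFin \o f)^\+ x
    - `|c|^-1%:E * \int[mu]_x (EFin \o f)^\- x)%E).
  congr fine; rewrite integralE; congr (_ - _)%E.
    by rewrite -ip; apply: eq_integral => x _; rewrite !funeposE.
  by rewrite -iN; apply: eq_integral => x _; rewrite !funenegE.
rewrite [in RHS]integralE.
have fp : (\int[mu]_x (EFin \o f)^\+ x \is a fin_num)%E.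
  by apply: integrable_pos_fin_num.
have fn : (\int[mu]_x (EFin \o f)^\- x \is a fin_num)%E.
  by apply: integrable_neg_fin_num.
rewrite -muleBr//; last exact: fin_num_adde_defr.
by rewrite fineM// fin_numB fp fn.
Qed.

End affine_change_of_variable.

Section polynomial_integral.
Context {R : realType}.
Local Notation mu := (@lebesgue_measure R).
Implicit Types (p : {poly R}) (a b : R).

Lemma integrable_poly p a b : mu.-integrable `[a, b] (fun x => p.[x]%:E).
Proof.
apply: (@continuous_compact_integrable _ (horner p)); first exact: segment_compact.
by apply: continuous_subspaceT; exact: continuous_horner.
Qed.

Lemma Rintegral_deriv_poly p a b : a <= b ->
  \int[mu]_(x in `[a, b]) p^`().[x] = p.[b] - p.[a].
Proof.
rewrite le_eqVlt => /predU1P[<-|ab].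
  by rewrite set_itv1 Rintegral_set1 subrr.
rewrite /Rintegral (@continuous_FTC2 _ (horner p^`()) (horner p))//.
- by apply: continuous_subspaceT; exact: continuous_horner.
- split.
  + by move=> x _; exact: derivable_horner.
  + by apply: cvg_at_right_filter; exact: continuous_horner.
  + by apply: cvg_at_left_filter; exact: continuous_horner.
- by move=> x _; rewrite derivE.
Qed.

End polynomial_integral.

(** * Iterated integrals of bounded functions supported in the unit cube *)

Section iterated_integral.
Context {R : realType}.
Local Notation mu := (@lebesgue_measure R).
Local Notation RM := (measurableTypeR R).

(* Joint measurability of [(t, s) |-> F t s] in the parameter [t] and the [n]
   entries of [s]: the entries are moved one by one into the parameter space,
   following the recursion of [iint]. *)
Fixpoint jmeas (n : nat) : forall (d : measure_display) (T : measurableType d),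
    (T -> seq R -> R) -> Prop :=
  match n with
  | 0%N => fun d T F => measurable_fun setT (fun t => F t [::])
  | n'.+1 => fun d T F => jmeas n' (fun (p : T * RM) s => F p.1 (p.2 :: s))
  end.

Definition cubeb (s : seq R) : R := (all (fun x => `|x| <= 1)%R s)%:R.

(** With [jmeas], this is the invariant of the inductions on the dimension: for [0 <= M] it
    survives, with the same [M], when the first entry of the sequence becomes a parameter. *)
Definition cbounded (n : nat) (T : Type) (F : T -> seq R -> R) (M : R) : Prop :=
  forall t s, size s = n -> `|F t s| <= M * cubeb s.

Lemma jmeas_comp n (d d' : measure_display) (T : measurableType d)
    (T' : measurableType d') (F : T -> seq R -> R) (h : T' -> T) :
  measurable_fun setT h -> jmeas n F -> jmeas n (fun t' => F (h t')).
Proof.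
elim: n d d' T T' F h => [|n IH] d d' T T' F h mh /=.
  by move=> mF; exact: measurableT_comp mF mh.
move=> jF; apply: (IH _ _ _ _ _ (fun p : T' * RM => (h p.1, p.2)) _ jF).
by apply: measurable_fun_pair => //; exact: measurableT_comp.
Qed.

Lemma jmeas_op1 n (d : measure_display) (T : measurableType d)
    (op : R -> R) (F : T -> seq R -> R) :
  measurable_fun setT op -> jmeas n F -> jmeas n (fun t s => op (F t s)).
Proof.
move=> mop; elim: n d T F => [|n IH] d T F /=; last exact: IH.
by move=> mF; exact: measurableT_comp mop mF.
Qed.

(** The hypothesis on [op] ranges over all measurable spaces because the parameter space grows by
    one factor at each step of the recursion. *)
Lemma jmeas_op2 n (d : measure_display) (T : measurableType d)
    (op : R -> R -> R) (F G : T -> seq R -> R) :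
  (forall (d' : measure_display) (T' : measurableType d') (f g : T' -> R),
    measurable_fun setT f -> measurable_fun setT g ->
    measurable_fun setT (fun t => op (f t) (g t))) ->
  jmeas n F -> jmeas n G -> jmeas n (fun t s => op (F t s) (G t s)).
Proof.
move=> mop; elim: n d T F G => [|n IH] d T F G /=; last exact: IH.
exact: mop.
Qed.

Lemma jmeasD n (d : measure_display) (T : measurableType d) (F G : T -> seq R -> R) :
  jmeas n F -> jmeas n G -> jmeas n (fun t s => F t s + G t s).
Proof. by apply: jmeas_op2 => d' T' f g mf mg; exact: measurable_funD. Qed.

Lemma jmeasM n (d : measure_display) (T : measurableType d) (F G : T -> seq R -> R) :
  jmeas n F -> jmeas n G -> jmeas n (fun t s => F t s * G t s).
Proof. by apply: jmeas_op2 => d' T' f g mf mg; exact: measurable_funM. Qed.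

Lemma jmeas_ler n (d : measure_display) (T : measurableType d) (F G : T -> seq R -> R) :
  jmeas n F -> jmeas n G -> jmeas n (fun t s => if F t s <= G t s then 1 else 0).
Proof.
apply: (@jmeas_op2 _ _ _ (fun x y => if x <= y then 1 else 0)) => d' T' f g mf mg.
by apply: measurable_fun_ifT => //; exact: measurable_fun_ler.
Qed.

Lemma jmeas_par n (d : measure_display) (T : measurableType d) (f : T -> R) :
  measurable_fun setT f -> jmeas n (fun t _ => f t).
Proof.
elim: n d T f => [|n IH] d T f mf //=.
by apply: (IH _ _ (fun p : T * RM => f p.1)); exact: measurableT_comp.
Qed.

Lemma jmeas_nth n (d : measure_display) (T : measurableType d) i :
  jmeas n (fun (_ : T) s => nth 0 s i).
Proof.
elim: n d T i => [|n IH] d T [|i] /=; try exact: measurable_cst.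
  by apply: (@jmeas_par _ _ _ (fun p : T * RM => p.2 : R)); exact: measurable_snd.
exact: IH.
Qed.

Lemma jmeas_sum n (d : measure_display) (T : measurableType d) (I : Type)
    (r : seq I) (F : I -> T -> seq R -> R) :
  (forall i, jmeas n (F i)) -> jmeas n (fun t s => \sum_(i <- r) F i t s).
Proof.
move=> mF; elim: r => [|i r IH].
  rewrite (_ : (fun t s => _) = (fun t _ => 0)); first exact: jmeas_par.
  by apply/funext => t; apply/funext => s; rewrite big_nil.
rewrite (_ : (fun t s => _) = (fun t s => F i t s + \sum_(j <- r) F j t s)).
  exact: jmeasD.
by apply/funext => t; apply/funext => s; rewrite big_cons.
Qed.

Lemma jmeas_prod n (d : measure_display) (T : measurableType d) (I : Type)
    (r : seq I) (F : I -> T -> seq R -> R) :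
  (forall i, jmeas n (F i)) -> jmeas n (fun t s => \prod_(i <- r) F i t s).
Proof.
move=> mF; elim: r => [|i r IH].
  rewrite (_ : (fun t s => _) = (fun t _ => 1)); first exact: jmeas_par.
  by apply/funext => t; apply/funext => s; rewrite big_nil.
rewrite (_ : (fun t s => _) = (fun t s => F i t s * \prod_(j <- r) F j t s)).
  exact: jmeasM.
by apply/funext => t; apply/funext => s; rewrite big_cons.
Qed.

Lemma jmeasX n (d : measure_display) (T : measurableType d) (F : T -> seq R -> R) k :
  jmeas n F -> jmeas n (fun t s => F t s ^+ k).
Proof. by apply: (jmeas_op1 (op := fun x => x ^+ k)); exact: exprn_measurable. Qed.

Lemma eq_iint n (F G : seq R -> R) :
  (forall s, size s = n -> F s = G s) -> iint n F = iint n G.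
Proof.
elim: n F G => [|n IH] F G FG /=; first exact: FG.
by congr Rintegral; apply/funext => y; apply: IH => s sn; apply: FG; rewrite /= sn.
Qed.

Lemma iint_eq0 n (F : seq R -> R) :
  (forall s, size s = n -> F s = 0) -> iint n F = 0.
Proof.
elim: n F => [|n IH] F F0 /=; first exact: F0.
rewrite (_ : (fun y => _) = (fun _ => 0)); first by rewrite Rintegral_cst// mul0r.
by apply/funext => y; apply: IH => s sn; apply: F0; rewrite /= sn.
Qed.

Lemma integrable_slab (h : R -> R) (K : R) : measurable_fun setT h ->
  (forall y, `|h y| <= K * (`|y| <= 1)%R%:R) -> mu.-integrable setT (EFin \o h).
Proof.
move=> mh hK.
have mI : measurable (`[-1, 1]%classic : set R) by [].
have -> : EFin \o h = (EFin \o h) \_ `[-1, 1]%classic.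
  apply/funext => y; rewrite patchE; case: ifPn => //.
  rewrite notin_setE/= in_itv/= -ler_norml => /negP y1.
  move: (hK y); rewrite (negbTE y1) mulr0 normr_le0 => /eqP hy.
  by rewrite /= hy.
apply: (iffLR (integrable_mkcond (mu := mu) (D := `[-1, 1]%classic) _ _)) => //.
apply: measurable_bounded_integrable => //.
- by rewrite /= lebesgue_measure_itv/= lte_fin; case: ifP; rewrite ?ltry// -EFinB ltry.
- exact: measurable_funTS.
- exists K; split; first exact: num_real.
  move=> x Kx y /=; rewrite in_itv/= -ler_norml => y1; rewrite (le_trans (hK y))// y1 mulr1.
  exact: ltW.
Qed.

Lemma Rintegral_slab (h : R -> R) (K : R) : measurable_fun setT h ->
  (forall y, `|h y| <= K * (`|y| <= 1)%R%:R) -> `|\int[mu]_y h y| <= K * 2.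
Proof.
move=> mh hK.
have ih := integrable_slab mh hK.
apply: (le_trans (le_normr_Rintegral _ ih)) => //.
have -> : \int[mu]_t `|h t| = \int[mu]_(t in `[-1, 1]) `|h t|.
  rewrite [RHS]Rintegral_mkcond; apply: eq_Rintegral => y _; rewrite patchE; case: ifPn => //.
  rewrite notin_setE/= in_itv/= -ler_norml => /negP y1.
  by apply/eqP; rewrite -normr_le0 normr_id; move: (hK y); rewrite (negbTE y1) mulr0.
apply: (@le_trans _ _ (\int[mu]_(t in `[-1, 1]) K)).
  apply: le_Rintegral => //.
  - apply: (integrableS measurableT) => //.
    by have := integrable_abse ih; apply: eq_integrable => //.
  - apply: (measurable_bounded_integrable (f := fun=> K)) => //=; last first.
      by exists `|K|; split; [exact: num_real|move=> x Kx y _; exact: ltW].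
    by rewrite lebesgue_measure_itv/= lte_fin; case: ifP; rewrite ?ltry// -EFinB ltry.
  - by move=> y; rewrite /= in_itv/= -ler_norml => y1; rewrite (le_trans (hK y))// y1 mulr1.
rewrite Rintegral_cst//= lebesgue_measure_itv/= lte_fin.
rewrite (_ : (-1 < 1 :> R) = true); last by apply/idP; lra.
by rewrite -EFinB/= opprK.
Qed.

(** Tonelli gives measurability of partial integrals of nonnegative functions; it is applied to the
    two parts of [H] separately. *)
Lemma measurable_Rintegral_par (d : measure_display) (T : measurableType d)
    (H : T * RM -> R) : measurable_fun setT H ->
  measurable_fun setT (fun t => \int[mu]_y H (t, y)).
Proof.
move=> mH.
have mEH : measurable_fun setT (EFin \o H) by exact/measurable_EFinP.
rewrite (_ : (fun t => _) = fine \o ((fubini_F mu (EFin \o H)^\+) \- (fubini_F mu (EFin \o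
    H)^\-))%E).
  apply: measurableT_comp; first exact: fine_measurable.
  apply: emeasurable_funB.
    by apply: measurable_fun_fubini_tonelli_F => //; exact: measurable_funepos.
  by apply: measurable_fun_fubini_tonelli_F => //; exact: measurable_funeneg.
apply/funext => t; rewrite /= /Rintegral integralE /fubini_F; congr (fine (_ - _)%E).
  by apply: eq_integral => y _; rewrite !funeposE.
by apply: eq_integral => y _; rewrite !funenegE.
Qed.

Lemma cbounded_cons n (T : Type) (F : T -> seq R -> R) (M : R) :
  0 <= M -> cbounded n.+1 F M -> cbounded n (fun (p : T * R) s => F p.1 (p.2 :: s)) M.
Proof.
move=> M0 bF [t y] s sn /=; apply: le_trans (bF t (y :: s) _) _; rewrite /= ?sn//.
by apply: ler_wpM2l => //; rewrite /cubeb /=; case: (`|y| <= 1) => //=; rewrite ler0n.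
Qed.

Lemma iint_cons_out n (T : Type) (F : T -> seq R -> R) (M : R) t y :
  cbounded n.+1 F M -> ~~ (`|y| <= 1) -> iint n (fun s => F t (y :: s)) = 0.
Proof.
move=> bF y1; apply: iint_eq0 => s sn; apply/eqP; rewrite -normr_le0.
apply: le_trans (bF t (y :: s) _) _; rewrite /= ?sn//.
by rewrite /cubeb /= (negbTE y1) mulr0.
Qed.

(** Measurability and bound go together, since the bound on the outer integral uses measurability of
    the inner one. Each integration is effectively over [[-1, 1]], hence the factor [2 ^+ n]. *)
Lemma measurable_iint n (d : measure_display) (T : measurableType d)
    (F : T -> seq R -> R) (M : R) : 0 <= M -> jmeas n F -> cbounded n F M ->
  measurable_fun setT (fun t => iint n (F t)) /\
  forall t, `|iint n (F t)| <= M * 2 ^+ n.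
Proof.
move=> M0; elim: n d T F => [|n IH] d T F jF bF /=.
  split => // t; rewrite expr0; apply: le_trans (bF t [::] erefl) _.
  by rewrite /cubeb.
have [mH bH] := IH _ _ _ jF (cbounded_cons M0 bF).
split; first exact: (measurable_Rintegral_par mH).
move=> t; rewrite exprSr mulrA; apply: Rintegral_slab.
  apply: (measurableT_comp mH (_ : measurable_fun setT (fun y : RM => (t, y)))).
  exact: measurable_pair1.
move=> y; case: (boolP (`|y| <= 1)) => y1; first by rewrite mulr1; exact: (bH (t, y)).
by rewrite (iint_cons_out _ bF y1) normr0 mulr0.
Qed.

Lemma integrable_iint n (d : measure_display) (T : measurableType d)
    (F : T -> seq R -> R) (M : R) t : 0 <= M -> jmeas n.+1 F -> cbounded n.+1 F M ->
  mu.-integrable setT (EFin \o (fun y => iint n (fun s => F t (y :: s)))).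
Proof.
move=> M0 jF bF.
have [mH bH] := measurable_iint M0 (jF : jmeas n _) (cbounded_cons M0 bF).
apply: (@integrable_slab _ (M * 2 ^+ n)).
  apply: (measurableT_comp mH (_ : measurable_fun setT (fun y : RM => (t, y)))).
  exact: measurable_pair1.
move=> y; case: (boolP (`|y| <= 1)) => y1; first by rewrite mulr1; exact: (bH (t, y)).
by rewrite (iint_cons_out _ bF y1) normr0 mulr0.
Qed.

Lemma iintD n (d : measure_display) (T : measurableType d)
    (F G : T -> seq R -> R) (M : R) t : 0 <= M -> jmeas n F -> cbounded n F M ->
  jmeas n G -> cbounded n G M ->
  iint n (fun s => F t s + G t s) = iint n (F t) + iint n (G t).
Proof.
move=> M0; elim: n d T F G t => [|n IH] d T F G t jF bF jG bG //=.
rewrite -RintegralD//; last 2 first.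
- exact: integrable_iint M0 jF bF.
- exact: integrable_iint M0 jG bG.
apply: eq_Rintegral => y _.
exact: (IH _ _ _ _ (t, y) jF (cbounded_cons M0 bF) jG (cbounded_cons M0 bG)).
Qed.

Lemma iintZ n (d : measure_display) (T : measurableType d)
    (F : T -> seq R -> R) (M c : R) t : 0 <= M -> jmeas n F -> cbounded n F M ->
  iint n (fun s => c * F t s) = c * iint n (F t).
Proof.
move=> M0; elim: n d T F t => [|n IH] d T F t jF bF //=.
rewrite -RintegralZl//; last exact: integrable_iint M0 jF bF.
apply: eq_Rintegral => y _.
exact: (IH _ _ _ (t, y) jF (cbounded_cons M0 bF)).
Qed.

Lemma iint_scale n (d : measure_display) (T : measurableType d)
    (F : T -> seq R -> R) (M c : R) t : 0 <= M -> 0 < c -> jmeas n F -> cbounded n F M ->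
  iint n (fun s => F t [seq c * x | x <- s]) = c ^- n * iint n (F t).
Proof.
move=> M0 c0; elim: n d T F t => [|n IH] d T F t jF bF /=.
  by rewrite expr0 invr1 mul1r.
transitivity (\int[mu]_y (c ^- n * iint n (fun s => F t (c * y :: s)))).
  apply: eq_Rintegral => y _.
  exact: (IH _ _ (fun (p : T * RM) s => F p.1 (p.2 :: s)) (t, c * y : RM) jF (cbounded_cons M0
      bF)).
have ii := integrable_iint t M0 jF bF.
rewrite (@Rintegral_scale _ c (fun y => c ^- n * iint n (fun s => F t (y :: s)))) ?gt_eqF//.
  rewrite RintegralZl// gtr0_norm// mulrA; congr (_ * _).
  by rewrite exprSr invfM mulrC.
exact: (integrableZl measurableT (c ^- n) ii).
Qed.

(** Domination by the indicator of a square makes [H] integrable for the product measure and every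
    inner integral finite, so Fubini for extended reals transfers through [fine]. *)
Lemma Rfubini (H : RM * RM -> R) (K : R) : 0 <= K -> measurable_fun setT H ->
  (forall x y, `|H (x, y)| <= K * (`|x| <= 1)%R%:R * (`|y| <= 1)%R%:R) ->
  \int[mu]_x \int[mu]_y H (x, y) = \int[mu]_y \int[mu]_x H (x, y).
Proof.
move=> K0 mH HK.
have mH1 x : measurable_fun setT (fun y => H (x, y)).
  by apply: (measurableT_comp mH); exact: measurable_pair1.
have mH2 y : measurable_fun setT (fun x => H (x, y)).
  by apply: (measurableT_comp mH); exact: measurable_pair2.
have i1 x : mu.-integrable setT (fun y => (H (x, y))%:E).
  exact: (integrable_slab (mH1 x) (HK x)).
have i2 y : mu.-integrable setT (fun x => (H (x, y))%:E).
  apply: (integrable_slab (K := K * (`|y| <= 1)%R%:R) (mH2 y)) => x.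
  by rewrite mulrAC; exact: HK.
have mEH : measurable_fun setT (EFin \o H) by exact/measurable_EFinP.
have iH : (mu \x mu)%E.-integrable setT (EFin \o H).
  apply/integrable12ltyP => //.
  have mnH : measurable_fun setT (fun z => `|H z|) by exact: measurableT_comp.
  have inH : mu.-integrable setT (EFin \o (fun x => \int[mu]_y `|H (x, y)|)).
    apply: (@integrable_slab _ (K * 2)); first exact: (measurable_Rintegral_par mnH).
    move=> x; rewrite mulrAC; apply: Rintegral_slab.
      by apply: measurableT_comp => //; exact: mH1.
    by move=> y; rewrite normr_id; exact: HK.
  rewrite (eq_integral (EFin \o (fun x => \int[mu]_y `|H (x, y)|))).
    by apply: integrable_lty => //.
  move=> x _ /=; rewrite fineK//.
  apply: integrable_fin_num => //.
  exact: (integrable_abse (i1 x)).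
rewrite /Rintegral; congr fine.
transitivity (\int[mu]_x \int[mu]_y (H (x, y))%:E)%E.
  by apply: eq_integral => x _; rewrite fineK//; exact: integrable_fin_num.
rewrite (Fubini iH); apply: eq_integral => y _; rewrite fineK//.
exact: integrable_fin_num.
Qed.

(** The variable [r] is exchanged with the first coordinate by [Rfubini]; that coordinate then joins
    the parameter [t] and the induction hypothesis moves [r] past the remaining ones. *)
Lemma iint_swap n (d : measure_display) (T : measurableType d)
    (F : T * RM -> seq R -> R) (M : R) t : 0 <= M -> jmeas n F ->
  (forall t r s, size s = n -> `|F (t, r) s| <= M * (`|r| <= 1)%R%:R * cubeb s) ->
  \int[mu]_r iint n (F (t, r)) = iint n (fun s => \int[mu]_r F (t, r) s).
Proof.
move=> M0; elim: n d T F t => [|n IH] d T F t jF bF //=.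
have bF' : cbounded n.+1 F M.
  move=> [u r] s sn; apply: le_trans (bF u r s sn) _; rewrite -mulrA.
  by apply: ler_wpM2l => //; case: (`|r| <= 1); rewrite ?mul1r// mul0r ler0n.
have [mH bH] := measurable_iint M0 (jF : jmeas n _) (cbounded_cons M0 bF').
rewrite (@Rfubini (fun p => iint n (fun s => F (t, p.1) (p.2 :: s))) (M * 2 ^+ n)).
- apply: eq_Rintegral => y _.
  (* The parameters are reordered so that [r] comes last again, as the induction hypothesis
     expects. *)
  apply: (IH _ _ (fun (q : (T * RM) * RM) s => F (q.1.1, q.2) (q.1.2 :: s)) (t, y)).
    apply: (jmeas_comp _ (jF : jmeas n _) (h := fun q : (T * RM) * RM => ((q.1.1, q.2), q.1.2))).
    apply: measurable_fun_pair; first apply: measurable_fun_pair => //.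
    + by apply: (measurableT_comp measurable_fst); exact: measurable_fst.
    + by apply: (measurableT_comp measurable_snd); exact: measurable_fst.
  move=> [u y'] r s sn /=; apply: le_trans (bF _ _ (y' :: s) _) _; rewrite /= ?sn//.
  apply: ler_wpM2l; first by rewrite mulr_ge0.
  by rewrite /cubeb /=; case: (`|y'| <= 1) => //=; rewrite ler0n.
- by rewrite mulr_ge0// exprn_ge0.
- apply: (measurableT_comp mH (_ : measurable_fun setT (fun p : RM * RM => ((t, p.1), p.2)))).
  by apply: measurable_fun_pair => //; apply: measurable_fun_pair.
- move=> r y /=; case: (boolP (`|r| <= 1)) => r1; last first.
    rewrite iint_eq0 ?normr0 ?mulr0 ?mul0r// => s sn; apply/eqP; rewrite -normr_le0.
    apply: le_trans (bF t r (y :: s) _) _; rewrite /= ?sn//.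
    by rewrite (negbTE r1) mulr0 mul0r.
  rewrite mulr1; case: (boolP (`|y| <= 1)) => y1; last first.
    by rewrite (iint_cons_out _ bF' y1) normr0 mulr0.
  by rewrite mulr1; exact: (bH ((t, r), y)).
Qed.

End iterated_integral.

(** * Moments of the unit ball through recursions for Beta integrals *)

Section ball_moments.
Context {R : realType}.
Local Notation mu := (@lebesgue_measure R).
Local Notation RM := (measurableTypeR R).
Implicit Types (a : nat -> nat) (rho : R).

(* [pw rho e] is [rho_+ ^ (e/2)], and for [e = 0] the indicator of [0 <= rho]:
   the family is stable, up to constants, under integration of slices of balls. *)
Definition pw (rho : R) (e : nat) : R := if 0 <= rho then Num.sqrt rho ^+ e else 0.

(** For even [k] this is the Beta value [B((k+1)/2, e/2+1)], for odd [k] it is 0. The proof works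
    with recursions in [k] and [e] rather than with the closed form. *)
Definition bmom (k e : nat) : R := \int[mu]_y (y ^+ k * pw (1 - y ^+ 2) e).

Lemma measurable_sqrt : measurable_fun [set: R] (@Num.sqrt R).
Proof. by apply: continuous_measurable_fun; exact: sqrt_continuous. Qed.

Lemma measurable_pw e : measurable_fun [set: R] (fun rho => pw rho e).
Proof.
apply: measurable_fun_ifT => //; first exact: measurable_fun_ler.
by apply: measurable_funX; exact: measurable_sqrt.
Qed.

Lemma measurable_bmom k e :
  measurable_fun [set: R] (fun y => y ^+ k * pw (1 - y ^+ 2) e).
Proof.
apply: measurable_funM; first exact: exprn_measurable.
apply: (measurableT_comp (measurable_pw e) (_ : measurable_fun [set: R] (fun y => 1 - y ^+ 2))).
by apply: measurable_funB => //; exact: exprn_measurable.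
Qed.

Lemma bmom_bound k e (y : R) :
  `|y ^+ k * pw (1 - y ^+ 2) e| <= 1 * (`|y| <= 1)%R%:R.
Proof.
rewrite mul1r /pw subr_ge0 -real_normK ?num_real//.
rewrite expr_le1// normrM normrX; case: (boolP (`|y| <= 1)) => y1; last first.
  by rewrite normr0 mulr0.
rewrite mulr_ile1// ?exprn_ile1// normrX exprn_ile1// ger0_norm ?sqrtr_ge0//.
by rewrite -[leRHS]sqrtr1 ler_wsqrtr// gerBl exprn_ge0.
Qed.

Lemma integrable_bmom k e :
  mu.-integrable setT (EFin \o (fun y => y ^+ k * pw (1 - y ^+ 2) e)).
Proof. exact: (integrable_slab (measurable_bmom k e) (bmom_bound k e)). Qed.

(** Substituting [y = sqrt(rho) z] produces [sqrt(rho)] to the power [k] from the monomial, [e] from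
    the weight and 1 from [dy]. *)
Lemma pw_slice k e rho :
  \int[mu]_y (y ^+ k * pw (rho - y ^+ 2) e) = bmom k e * pw rho (k + e).+1.
Proof.
case: (ltrgtP rho 0) => r0.
- rewrite (_ : (fun y => _) = fun=> 0).
    by rewrite Rintegral_cst// mul0r /pw leNgt r0 mulr0.
  apply/funext => y; rewrite /pw ifF ?mulr0//; apply/negbTE; rewrite -ltNge.
  by rewrite subr_lt0 (lt_le_trans r0)// sqr_ge0.
- have c0 : 0 < Num.sqrt rho by rewrite sqrtr_gt0.
  set c := Num.sqrt rho in c0 *.
  rewrite (_ : (fun y => _) = (fun y => (fun z => c ^+ (k + e) * (z ^+ k * pw (1 - z ^+ 2) e))
      (c^-1 * y))).
    rewrite (@Rintegral_scale _ c^-1 (fun z => c ^+ (k + e) * (z ^+ k * pw (1 - z ^+ 2) e)))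
        ?invr_eq0 ?gt_eqF//; last first.
      exact: (integrableZl measurableT (c ^+ (k + e)) (integrable_bmom k e)).
    rewrite RintegralZl//; last exact: integrable_bmom.
    rewrite /pw (ltW r0) -/c -/(bmom k e) normfV invrK gtr0_norm// exprS.
    by rewrite mulrA mulrC.
  apply/funext => y.
  have -> : rho - y ^+ 2 = c ^+ 2 * (1 - (c^-1 * y) ^+ 2).
    rewrite mulrBr mulr1 -exprMn mulrA divff ?gt_eqF// mul1r sqr_sqrtr//.
    exact: ltW.
  rewrite /pw pmulr_rge0 ?exprn_gt0//; case: ifPn => h; last by rewrite !mulr0.
  rewrite sqrtrM ?sqr_ge0// sqrtr_sqr gtr0_norm// !exprMn exprD.
  have ck : c ^+ k * c^-1 ^+ k = 1 by rewrite -exprMn divff ?expr1n// gt_eqF.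
  move: (Num.sqrt _ ^+ e) => q.
  transitivity ((c ^+ k * c^-1 ^+ k) * (y ^+ k * (c ^+ e * q))); first by rewrite ck mul1r.
  by ring.
(* For [rho = 0] the integrand lives on the null set [{0}], and the right side vanishes because its
   exponent is positive. *)
- rewrite r0 /pw lexx sqrtr0 expr0n /= mulr0.
  rewrite -[RHS](Rintegral_set1 (fun y : R => y ^+ k * pw (0 - y ^+ 2) e) 0).
  rewrite [RHS]Rintegral_mkcond; apply: eq_Rintegral => y _; rewrite patchE /pw.
  case: (boolP (y \in [set 0])) => //; rewrite notin_setE/= => y0; rewrite ifF ?mulr0//.
  apply/negbTE; rewrite -ltNge sub0r oppr_lt0 exprn_even_gt0//=; exact/eqP.
Qed.

Lemma bmom_itv k e :
  bmom k e = \int[mu]_(y in `[-1, 1]) (y ^+ k * Num.sqrt (1 - y ^+ 2) ^+ e).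
Proof.
rewrite [RHS]Rintegral_mkcond; apply: eq_Rintegral => y _; rewrite patchE /pw.
rewrite subr_ge0 -[y ^+ 2 in LHS]real_normK ?num_real// expr_le1//.
have -> : (y \in `[-1, 1]%classic) = (`|y| <= 1).
  by apply/idP/idP; rewrite inE /= in_itv/= -ler_norml.
by case: ifPn => _; rewrite ?mulr0// real_normK ?num_real.
Qed.

Lemma continuous_sqrt1B : continuous (fun y : R => Num.sqrt (1 - y ^+ 2)).
Proof.
move=> y; apply: (@continuous_comp _ _ _ (fun y : R => 1 - y ^+ 2) Num.sqrt); last exact:
    sqrt_continuous.
by apply: cvgB; [exact: cvg_cst|exact: exprn_continuous].
Qed.

Lemma continuous_bmom k e : continuous (fun y : R => y ^+ k * Num.sqrt (1 - y ^+ 2) ^+ e).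
Proof.
have c1 : continuous ((fun z : R => z ^+ e) \o (fun y : R => Num.sqrt (1 - y ^+ 2))).
  by move=> x; apply: continuous_comp; [exact: continuous_sqrt1B|exact: exprn_continuous].
by move=> y; exact: (cvgM (@exprn_continuous R k y) (c1 y)).
Qed.

Lemma integrable_bmom_itv k e :
  mu.-integrable `[-1, 1] (EFin \o (fun y : R => y ^+ k * Num.sqrt (1 - y ^+ 2) ^+ e)).
Proof.
apply: continuous_compact_integrable; first exact: segment_compact.
by apply: continuous_subspaceT; exact: continuous_bmom.
Qed.

(** The root is not differentiable at the endpoints. The exponent [e.+2] absorbs the singular
    factor, so the derivative formula extends continuously to [[-1, 1]]. *)
Lemma is_derive_bmom k e (y : R) : `|y| < 1 ->
  is_derive y 1 (fun y : R => y ^+ k * Num.sqrt (1 - y ^+ 2) ^+ e.+2)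
    (k%:R * (y ^+ k.-1 * Num.sqrt (1 - y ^+ 2) ^+ e.+2)
     - e.+2%:R * (y ^+ k.+1 * Num.sqrt (1 - y ^+ 2) ^+ e)).
Proof.
move=> y1.
have r0 : 0 < 1 - y ^+ 2 by rewrite subr_gt0 -real_normK ?num_real// expr_lt1.
have s0 : Num.sqrt (1 - y ^+ 2) != 0 by rewrite gt_eqF// sqrtr_gt0.
have d1 : is_derive y (1:R) (horner (1 - 'X^2)) (- (2 * y)).
  by apply: is_derive_eq; rewrite !poly.derivE !hornerE /= mulr2n; ring.
have e1 : (1 - 'X^2 : {poly R}).[y] = 1 - y ^+ 2 by rewrite !hornerE.
have d2 : is_derive y (1:R) (Num.sqrt \o horner (1 - 'X^2)) ((2 * Num.sqrt (1 - y ^+ 2))^-1 *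
    (- (2 * y))).
  apply: is_derive1_comp; rewrite e1; exact: is_derive1_sqrt.
have d3 : is_derive y (1:R) (horner 'X^k) (k%:R * y ^+ k.-1).
  by apply: is_derive_eq; rewrite derivXn hornerMn hornerXn mulr_natl.
have := is_deriveM d3 (is_deriveX e.+2 d2).
rewrite (_ : horner 'X^k * (Num.sqrt \o horner (1 - 'X^2)) ^+ e.+2 =
  (fun y : R => y ^+ k * Num.sqrt (1 - y ^+ 2) ^+ e.+2)); last first.
  by apply/funext => z; rewrite !fctE /= !hornerE.
move=> H; apply: is_derive_eq; rewrite /= exprfctE /= e1 hornerXn /GRing.scale /=.
move: s0 (e.+2%:R : R) => /[swap] E; move: (Num.sqrt _) => S S0.
by rewrite !exprS; field; rewrite S0.
Qed.

(** The primitive vanishes at both endpoints because its root has positive exponent. For [k = 0] the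
    identity says that [bmom 1 e] is 0. *)
Lemma bmom_parts k e :
  k%:R * bmom k.-1 e.+2 = e.+2%:R * bmom k.+1 e.
Proof.
pose F := fun y : R => y ^+ k * Num.sqrt (1 - y ^+ 2) ^+ e.+2.
pose f := fun y : R => k%:R * (y ^+ k.-1 * Num.sqrt (1 - y ^+ 2) ^+ e.+2)
     - e.+2%:R * (y ^+ k.+1 * Num.sqrt (1 - y ^+ 2) ^+ e).
have lt11 : (-1 < 1 :> R) by lra.
have cF : continuous F by exact: continuous_bmom.
have F0 : \int[mu]_(y in `[-1, 1]) f y = 0.
  rewrite /Rintegral (@continuous_FTC2 _ f F)//.
  - by rewrite -EFinB/= /F expr1n sqrrN expr1n subrr sqrtr0 !expr0n /= !mulr0 subrr.
  - apply: continuous_subspaceT => y; apply: cvgB; apply: cvgM;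
      [exact: cvg_cst|exact: continuous_bmom|exact: cvg_cst|exact: continuous_bmom].
  - split.
    + move=> y; rewrite in_itv/= -ltr_norml => y1.
      by case: (is_derive_bmom k e y1).
    + by apply: cvg_at_right_filter; exact: cF.
    + by apply: cvg_at_left_filter; exact: cF.
  - move=> y; rewrite in_itv/= -ltr_norml => y1; rewrite derive1E.
    by case: (is_derive_bmom k e y1).
move: F0; rewrite /f RintegralB//; last 2 first.
- exact: (integrableZl _ k%:R (integrable_bmom_itv k.-1 e.+2)).
- exact: (integrableZl _ e.+2%:R (integrable_bmom_itv k.+1 e)).
rewrite !RintegralZl//; try exact: integrable_bmom_itv.
by rewrite -!bmom_itv => /eqP; rewrite subr_eq0 => /eqP.
Qed.

Lemma bmom_split k e : bmom k e.+2 = bmom k e - bmom k.+2 e.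
Proof.
rewrite /bmom -RintegralB//; try exact: integrable_bmom.
apply: eq_Rintegral => y _; rewrite /pw; case: ifPn => h; last by rewrite !mulr0 subr0.
by rewrite -[in LHS](addn2 e) exprD sqr_sqrtr// -(addn2 k) exprD; ring.
Qed.

Lemma bmom_rec k e : (k + e.+2)%:R * bmom k.+1 e = k%:R * bmom k.-1 e.
Proof.
case: k => [|k]; first by rewrite add0n -bmom_parts !mul0r.
have := bmom_parts k.+1 e; rewrite /= bmom_split natrD => h.
by rewrite mulrDl -h; ring.
Qed.

Lemma bmom_rec2 k e : (k + e.+3)%:R * bmom k e.+2 = e.+2%:R * bmom k e.
Proof.
have := bmom_rec k.+1 e; rewrite /= addSnnS => h.
by rewrite bmom_split mulrBr h -!natr1 natrD -!natr1; ring.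
Qed.

Definition sqn (n : nat) (s : seq R) : R := \sum_(i < n) nth 0 s i ^+ 2.
Definition monn (n : nat) (a : nat -> nat) (s : seq R) : R :=
  \prod_(i < n) nth 0 s i ^+ a i.
(** Degree plus dimension: the exponent with which the integral of the monomial over a ball scales
    with the radius. *)
Definition wt (n : nat) (a : nat -> nat) : nat := (\sum_(i < n) (a i).+1)%N.
(* [cmom n a] is the integral of the monomial with exponents [a 0, ..., a (n-1)]
   over the unit ball of R^n, see [iint_ballmon]. *)
Fixpoint cmom (n : nat) (a : nat -> nat) : R :=
  match n with
  | 0%N => 1
  | n'.+1 => bmom (a 0%N) (wt n' (fun i => a i.+1)) * cmom n' (fun i => a i.+1)
  end.

Lemma sqn_nth n s (i : 'I_n) : nth 0 s i ^+ 2 <= sqn n s.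
Proof.
rewrite /sqn (bigD1 i)//= lerDl; apply: sumr_ge0 => j _; exact: sqr_ge0.
Qed.

Lemma sqn_cubeb n s : size s = n -> sqn n s <= 1 -> cubeb s = 1.
Proof.
move=> sn s1; rewrite /cubeb; suff -> : all (fun x => `|x| <= 1) s by [].
apply/(all_nthP 0) => i; rewrite sn => lin.
rewrite -(@expr_le1 _ 2)// real_normK ?num_real//.
exact: le_trans (sqn_nth s (Ordinal lin)) s1.
Qed.

Lemma jmeas_sqn n k (d : measure_display) (T : measurableType d) :
  jmeas k (fun (_ : T) s => sqn n s).
Proof. by apply: jmeas_sum => i; apply: jmeasX; exact: jmeas_nth. Qed.

Lemma jmeas_monn n k a (d : measure_display) (T : measurableType d) :
  jmeas k (fun (_ : T) s => monn n a s).
Proof. by apply: jmeas_prod => i; apply: jmeasX; exact: jmeas_nth. Qed.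

Lemma monn_le1 n a s : sqn n s <= 1 -> `|monn n a s| <= 1.
Proof.
move=> s1; rewrite /monn normr_prod; apply: prodr_ile1 => i _.
rewrite normr_ge0 /= normrX exprn_ile1// -(@expr_le1 _ 2)// real_normK ?num_real//.
exact: le_trans (sqn_nth s i) s1.
Qed.

Lemma jmeas_ballmon n a rho (d : measure_display) (T : measurableType d) :
  jmeas n (fun (_ : T) s => (if sqn n s <= rho then 1 else 0) * monn n a s).
Proof.
apply: jmeasM; last exact: jmeas_monn.
by apply: jmeas_ler; [exact: jmeas_sqn|apply: jmeas_par].
Qed.

Lemma cbounded_ballmon n a rho (T : Type) : rho <= 1 ->
  cbounded n (fun (_ : T) s => (if sqn n s <= rho then 1 else 0) * monn n a s) 1.
Proof.
move=> r1 _ s sn; rewrite mul1r; case: ifPn => h; last first.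
  by rewrite mul0r normr0 /cubeb ler0n.
have h1 := le_trans h r1.
by rewrite mul1r (sqn_cubeb sn h1) monn_le1.
Qed.

(** The slice of the ball at first coordinate [y] is a ball of squared radius [rho - y^2], possibly
    empty; this is why [rho] varies in the induction. The bound [rho <= 1] keeps everything in the
    cube. *)
Lemma iint_ballmon n a rho : rho <= 1 ->
  iint n (fun s => (if sqn n s <= rho then 1 else 0) * monn n a s)
  = cmom n a * pw rho (wt n a).
Proof.
elim: n a rho => [|n IH] a rho r1 /=.
  by rewrite /sqn /monn /wt !big_ord0 /pw expr0 mulr1 mul1r.
transitivity (\int[mu]_y (cmom n (fun i => a i.+1) *
    (y ^+ a 0%N * pw (rho - y ^+ 2) (wt n (fun i => a i.+1))))).
  apply: eq_Rintegral => y _.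
  have ry : rho - y ^+ 2 <= 1 by rewrite (le_trans _ r1)// gerBl sqr_ge0.
  rewrite mulrCA -(IH _ _ ry).
  rewrite -(iintZ (y ^+ a 0%N) tt ler01 (@jmeas_ballmon n _ (rho - y ^+ 2) _ unit)
      (@cbounded_ballmon n (fun i => a i.+1) _ unit ry)).
  apply: eq_iint => s sn; rewrite /sqn /monn !big_ord_recl/= lerBrDl.
  by rewrite mulrCA.
have pi : mu.-integrable setT (EFin \o (fun y : R => y ^+ a 0%N * pw (rho - y ^+ 2) (wt n (fun
    i => a i.+1)))).
  apply: (@integrable_slab _ _ 1).
    apply: measurable_funM; first exact: exprn_measurable.
    apply: (measurableT_comp (measurable_pw _) (_ : measurable_fun [set: R] (fun y => rho - y
        ^+ 2))).
    by apply: measurable_funB => //; exact: exprn_measurable.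
  move=> y; rewrite /pw subr_ge0; case: ifPn => h; last by rewrite mulr0 normr0 mul1r ler0n.
  have y1 : `|y| <= 1 by rewrite -(@expr_le1 _ 2)// real_normK ?num_real// (le_trans h).
  rewrite y1 mulr1 normrM normrX mulr_ile1// ?exprn_ile1// normrX exprn_ile1// ger0_norm
      ?sqrtr_ge0//.
  by rewrite -[leRHS]sqrtr1 ler_wsqrtr// (le_trans _ r1)// gerBl sqr_ge0.
rewrite RintegralZl// pw_slice mulrCA mulrA /wt big_ord_recl /=.
by congr (_ * pw _ _).
Qed.

Definition inc (i : nat) (a : nat -> nat) : nat -> nat :=
  fun j => if j == i then (a j).+1 else a j.
Definition dec (i : nat) (a : nat -> nat) : nat -> nat :=
  fun j => if j == i then (a j).-1 else a j.

Lemma wt_inc n i a : (i < n)%N -> wt n (inc i a) = (wt n a).+1.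
Proof.
move=> lin; rewrite /wt (bigD1 (Ordinal lin))//= [in RHS](bigD1 (Ordinal lin))//=.
rewrite /inc eqxx -addSn; congr addn; apply: eq_bigr => j.
by rewrite -val_eqE/= => /negbTE ->.
Qed.

Lemma wt_dec n i a : (i < n)%N -> (0 < a i)%N -> (wt n (dec i a)).+1 = wt n a.
Proof.
move=> lin ai; rewrite /wt (bigD1 (Ordinal lin))//= [in RHS](bigD1 (Ordinal lin))//=.
rewrite /dec eqxx -addSn prednK//; congr addn; apply: eq_bigr => j.
by rewrite -val_eqE/= => /negbTE ->.
Qed.

(** This is the divergence theorem for monomials. For [i = 0] only the leading Beta factor changes
    ([bmom_rec]). For later [i] the tail weights of the two sides differ by 2, and [bmom_rec2]
    compensates for this in the leading factor. *)
Lemma cmom_inc n i a : (i < n)%N ->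
  (wt n a).+1%:R * cmom n (inc i a) = (a i)%:R * cmom n (dec i a).
Proof.
elim: n i a => [//|n IH] [|i] a lin /=.
  rewrite /wt big_ord_recl /= -/(wt n (fun i => a i.+1)).
  rewrite !mulrA -bmom_rec; congr (_%:R * _ * _).
  by rewrite addSn !addnS.
have {IH} := IH i (fun j => a j.+1) lin; set a' := fun j => a j.+1.
rewrite -[fun j => inc i.+1 a j.+1]/(inc i a') -[fun j => dec i.+1 a j.+1]/(dec i a').
rewrite wt_inc// => IH.
have -> : inc i.+1 a 0%N = a 0%N by [].
have -> : dec i.+1 a 0%N = a 0%N by [].
(* If the exponent is 0, [dec] truncates and the weight relation fails, but the induction hypothesis
   then says that the increased moment is 0. *)
case: (posnP (a' i)) => ai.
  move: IH; rewrite [in LHS]/a' -/(a' i) ai !mul0r => /eqP.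
  by rewrite mulf_eq0 pnatr_eq0/= => /eqP ->; rewrite !mulr0.
have wd := @wt_dec n i a' lin ai.
have := bmom_rec2 (a 0%N) (wt n (dec i a')).
rewrite wd => h.
have -> : (wt n.+1 a).+1 = (a 0%N + (wt n a').+2)%N.
  by rewrite /wt big_ord_recl/= addSn !addnS.
rewrite mulrA h -mulrA mulrCA IH.
by rewrite mulrCA.
Qed.

End ball_moments.

(** * Green identities on the ball, comparison of sphere and ball, orthogonality of harmonics *)

Section sphere_and_ball.
Context {R : realType} {d : nat}.
Local Notation mu := (@lebesgue_measure R).
Local Notation RM := (measurableTypeR R).
Local Notation poly := (mpoly.mpoly d R).
Local Notation mon := (mpoly.multinom d).
Local Notation XM m := (mpoly.mpolyX R m).
Local Notation XU i := (mpoly.mpolyX R (mpoly.mnm1 i)).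
Implicit Types (p q g : poly) (m : mon) (s : seq R).

Definition row_of (s : seq R) : 'rV[R]_d := \row_i nth 0 s i.

Definition mhom (k : nat) (p : poly) : Prop :=
  forall m, m \in mpoly.msupp p -> mpoly.mdeg m = k.

Definition pnorm (p : poly) : R := \sum_(m <- mpoly.msupp p) `|mpoly.mcoeff m p|.

Lemma pnorm_ge0 p : 0 <= pnorm p.
Proof. by apply: sumr_ge0. Qed.

Lemma enorm_row s : enorm (row_of s) = Num.sqrt (sqn d s).
Proof. by rewrite /enorm /sqn; congr Num.sqrt; apply: eq_bigr => i _; rewrite mxE. Qed.

Lemma enorm_row_ge0 s : 0 <= enorm (row_of s).
Proof. by rewrite enorm_row sqrtr_ge0. Qed.

Lemma enorm_row_le1 s : (enorm (row_of s) <= 1) = (sqn d s <= 1).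
Proof. by rewrite enorm_row -[in LHS]sqrtr1 ler_sqrt. Qed.

Lemma nth_le_enorm s (i : 'I_d) : `|nth 0 s i| <= enorm (row_of s).
Proof. by rewrite enorm_row -sqrtr_sqr ler_wsqrtr// sqn_nth. Qed.

Lemma pevalE p (x : 'rV[R]_d) : peval p x =
  \sum_(m <- mpoly.msupp p) mpoly.mcoeff m p * \prod_(i < d) x ord0 i ^+ m i.
Proof. exact: mpoly.mevalE. Qed.

Lemma pevalM p q (x : 'rV[R]_d) : peval (p * q) x = peval p x * peval q x.
Proof. exact: mpoly.mevalM. Qed.

Lemma peval_le p (x : 'rV[R]_d) : (forall i, `|x ord0 i| <= 1) -> `|peval p x| <= pnorm p.
Proof.
move=> x1; rewrite pevalE (le_trans (ler_norm_sum _ _ _))//.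
apply: ler_sum => m _; rewrite normrM ler_piMr// normr_prod.
by apply: prodr_ile1 => i _; rewrite normr_ge0 normrX exprn_ile1.
Qed.

Lemma peval_hom k p (c : R) (x : 'rV[R]_d) : mhom k p -> peval p (c *: x) = c ^+ k * peval p x.
Proof.
move=> hp; rewrite !pevalE mulr_sumr big_seq [RHS]big_seq; apply: eq_bigr => m /hp <-.
rewrite mulrCA; congr (_ * _); rewrite mpoly.mdegE.
under [LHS]eq_bigr do rewrite mxE exprMn.
by rewrite big_split/= expr_sum.
Qed.

Lemma jmeas_peval n (d' : measure_display) (T : measurableType d') p
    (X : T -> seq R -> 'rV[R]_d) :
  (forall i, jmeas n (fun t s => X t s ord0 i)) -> jmeas n (fun t s => peval p (X t s)).
Proof.
move=> jX; rewrite (_ : (fun t s => _) = (fun t s =>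
  \sum_(m <- mpoly.msupp p) mpoly.mcoeff m p * \prod_(i < d) X t s ord0 i ^+ m i)).
  apply: jmeas_sum => m; apply: jmeasM; first exact: jmeas_par.
  by apply: jmeas_prod => i; apply: jmeasX.
by apply/funext => t; apply/funext => s; rewrite pevalE.
Qed.

Lemma jmeas_row n (d' : measure_display) (T : measurableType d') i :
  jmeas n (fun (_ : T) s => row_of s ord0 i).
Proof.
rewrite (_ : (fun _ s => _) = (fun _ s => nth 0 s i)); first exact: jmeas_nth.
by apply/funext => t; apply/funext => s; rewrite mxE.
Qed.

Lemma jmeas_enorm n (d' : measure_display) (T : measurableType d') :
  jmeas n (fun (_ : T) s => enorm (row_of s)).
Proof.
rewrite (_ : (fun _ s => _) = (fun _ s => Num.sqrt (sqn d s))).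
  by apply: jmeas_op1; [exact: measurable_sqrt|exact: jmeas_sqn].
by apply/funext => t; apply/funext => s; rewrite enorm_row.
Qed.

(** On nonnegative reals the inverse is [powR x (-1)], including at 0, where both are 0. Norms take
    only such values. *)
Lemma measurable_inv_nneg : measurable_fun [set: R] (fun x : R => if 0 <= x then x^-1 else 0).
Proof.
rewrite (_ : (fun x => _) = (fun x => if 0 <= x then powR x (-1) else 0)).
  apply: measurable_fun_ifT; [exact: measurable_fun_ler| |exact: measurable_cst].
  exact: (@measurable_powR R (-1)).
by apply/funext => x; case: ifPn => // x0; rewrite powR_inv1.
Qed.

(** The extension of [g] from the sphere that is constant along rays. At the origin, where the
    inverse of 0 is 0, it takes the value of [g] at 0. *)
Definition gsph (g : poly) (s : seq R) : R :=
  peval g ((enorm (row_of s))^-1 *: row_of s).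

Lemma jmeas_gsph n (d' : measure_display) (T : measurableType d') g :
  jmeas n (fun (_ : T) s => gsph g s).
Proof.
apply: jmeas_peval => i.
rewrite (_ : (fun _ s => _) = (fun _ s =>
  (fun x : R => if 0 <= x then x^-1 else 0) (enorm (row_of s)) * row_of s ord0 i)).
  apply: jmeasM; last exact: jmeas_row.
  apply: (jmeas_op1 (op := fun x : R => if 0 <= x then x^-1 else 0)).
    exact: measurable_inv_nneg.
  exact: jmeas_enorm.
by apply/funext => t; apply/funext => s; rewrite [LHS]mxE enorm_row_ge0.
Qed.

Lemma gsph_le g s : `|gsph g s| <= pnorm g.
Proof.
apply: peval_le => i; rewrite !mxE normrM normfV (ger0_norm (enorm_row_ge0 s)).
have := nth_le_enorm s i; have := enorm_row_ge0 s.
rewrite le_eqVlt => /predU1P[<- _|e0 h]; first by rewrite invr0 mul0r.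
by rewrite mulrC ler_pdivrMr// mul1r.
Qed.

Lemma jmeas_ball n (d' : measure_display) (T : measurableType d') F :
  jmeas n (fun (_ : T) => F) ->
  jmeas n (fun (_ : T) s => (if enorm (row_of s) <= 1 then 1 else 0) * F s).
Proof.
move=> jF; apply: jmeasM => //.
by apply: jmeas_ler; [exact: jmeas_enorm|exact: jmeas_par].
Qed.

Lemma cbounded_ball (T : Type) F M : 0 <= M ->
  (forall s, enorm (row_of s) <= 1 -> `|F s| <= M) ->
  cbounded d (fun (_ : T) s => (if enorm (row_of s) <= 1 then 1 else 0) * F s) M.
Proof.
move=> M0 bF _ s sn; case: ifPn => h; last first.
  by rewrite mul0r normr0 mulr_ge0// /cubeb ler0n.
rewrite mul1r (@sqn_cubeb _ d)// ?mulr1; first exact: bF.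
by rewrite -enorm_row_le1.
Qed.

Definition ballint (p : poly) : R :=
  lebint (fun x => (if enorm x <= 1 then 1 else 0) * peval p x).

Definition sphL (p : poly) : R :=
  lebint (fun x => (if enorm x <= 1 then 1 else 0) * peval p ((enorm x)^-1 *: x)).

Lemma jmeas_ballp p :
  jmeas d (fun (_ : unit) s => (if enorm (row_of s) <= 1 then 1 else 0) * peval p (row_of s)).
Proof. by apply: jmeas_ball; apply: jmeas_peval => i; exact: jmeas_row. Qed.

Lemma cbounded_ballp p M : pnorm p <= M ->
  cbounded d (fun (_ : unit) s => (if enorm (row_of s) <= 1 then 1 else 0) * peval p (row_of
      s)) M.
Proof.
move=> pM; have M0 : 0 <= M by apply: le_trans pM; exact: pnorm_ge0.
apply: cbounded_ball => // s s1; apply: le_trans pM; apply: peval_le => i.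
by rewrite mxE; apply: le_trans (nth_le_enorm s i) s1.
Qed.

Lemma jmeas_sphp p :
  jmeas d (fun (_ : unit) s => (if enorm (row_of s) <= 1 then 1 else 0) * gsph p s).
Proof. by apply: jmeas_ball; exact: jmeas_gsph. Qed.

Lemma cbounded_sphp p M : pnorm p <= M ->
  cbounded d (fun (_ : unit) s => (if enorm (row_of s) <= 1 then 1 else 0) * gsph p s) M.
Proof.
move=> pM; have M0 : 0 <= M by apply: le_trans pM; exact: pnorm_ge0.
by apply: cbounded_ball => // s s1; apply: le_trans pM; exact: gsph_le.
Qed.

Lemma ballint_comb c p q : ballint (c *: p + q) = c * ballint p + ballint q.
Proof.
(* A common bound for both summands, as [iintD] takes a single [M]. *)
pose M := `|c| * pnorm p + pnorm q.
have M0 : 0 <= M by rewrite addr_ge0// ?mulr_ge0// pnorm_ge0.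
rewrite -[c * _](iintZ c tt (pnorm_ge0 p) (jmeas_ballp p) (cbounded_ballp (lexx _))).
rewrite -[RHS](iintD (F := fun (_ : unit) s =>
    c * ((if enorm (row_of s) <= 1 then 1 else 0) * peval p (row_of s)))
  (G := fun (_ : unit) s => (if enorm (row_of s) <= 1 then 1 else 0) * peval q (row_of s)) (M
      := M) tt)//.
- apply: eq_iint => s sn; rewrite /peval mpoly.mevalD mpoly.mevalZ -/(peval p _) -/(peval q _).
  by rewrite mulrDr mulrCA.
- by apply: jmeasM; [exact: jmeas_par|exact: jmeas_ballp].
- move=> t s sn; rewrite normrM; apply: (@le_trans _ _ (`|c| * (pnorm p * cubeb s))).
    by apply: ler_wpM2l => //; apply: (cbounded_ballp (lexx _) t).
  by rewrite mulrA ler_wpM2r ?ler0n// lerDl pnorm_ge0.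
- exact: jmeas_ballp.
- by apply: cbounded_ballp; rewrite lerDr mulr_ge0// pnorm_ge0.
Qed.

Lemma ballint0 : ballint 0 = 0.
Proof. by apply: iint_eq0 => s sn; rewrite /peval mpoly.meval0 mulr0. Qed.

Lemma ballintZ c p : ballint (c *: p) = c * ballint p.
Proof. by rewrite -[c *: p]addr0 ballint_comb ballint0 addr0. Qed.

Lemma ballintD p q : ballint (p + q) = ballint p + ballint q.
Proof. by rewrite -[p]scale1r ballint_comb mul1r scale1r. Qed.

Lemma ballint_sum (I : Type) (r : seq I) (F : I -> poly) :
  ballint (\sum_(i <- r) F i) = \sum_(i <- r) ballint (F i).
Proof. exact: (big_morph ballint ballintD ballint0). Qed.

(** Extension by zero, to match the exponents indexed by all naturals that the recursion of [cmom]
    shifts. *)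
Definition mfun (m : mon) (j : nat) : nat :=
  if insub j is Some i then m i else 0%N.

Lemma mfunE m (i : 'I_d) : mfun m i = m i.
Proof. by rewrite /mfun valK. Qed.

Lemma mfun_inc m (i : 'I_d) : mfun (mpoly.mnm_add (mpoly.mnm1 i) m) = inc i (mfun m).
Proof.
apply/funext => j; rewrite /inc /mfun; case: insubP => [k _ <-|jd].
  by rewrite mpoly.mnmDE mpoly.mnm1E -val_eqE/= eq_sym; case: eqP.
by case: eqP jd => // ->; rewrite ltn_ord.
Qed.

Lemma mfun_dec m (i : 'I_d) : mfun (mpoly.mnm_sub m (mpoly.mnm1 i)) = dec i (mfun m).
Proof.
apply/funext => j; rewrite /dec /mfun; case: insubP => [k _ <-|jd].
  by rewrite mpoly.mnmBE mpoly.mnm1E -val_eqE/= eq_sym; case: eqP; rewrite ?subn1 ?subn0.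
by case: eqP.
Qed.

Lemma wt_mfun m : wt d (mfun m) = (mpoly.mdeg m + d)%N.
Proof.
rewrite /wt mpoly.mdegE; under [LHS]eq_bigr do rewrite mfunE -addn1.
by rewrite big_split/= sum1_card card_ord.
Qed.

Lemma ballintX m : ballint (XM m) = cmom d (mfun m).
Proof.
have := iint_ballmon d (mfun m) (lexx (1 : R)).
rewrite /pw ler01 sqrtr1 expr1n mulr1 => <-.
apply: eq_iint => s sn; rewrite -/(row_of s) enorm_row_le1 /peval mpoly.mevalX.
by congr (_ * _); apply: eq_bigr => i _; rewrite mxE mfunE.
Qed.

Lemma ballint_green_mon m (i : 'I_d) :
  ballint (mpoly.mderiv i (XM m)) = (mpoly.mdeg m + d).+1%:R * ballint (XU i * XM m).
Proof.
rewrite mpoly.mderivX ballintZ -mpoly.mpolyXD !ballintX mfun_inc mfun_dec.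
by rewrite -wt_mfun cmom_inc// mfunE.
Qed.

(* The divergence theorem on the unit ball: on the boundary the outward normal
   is [x] itself, and the radial homogeneity turns the boundary integral back
   into an integral over the ball. *)
Lemma ballint_green k p (i : 'I_d) : mhom k p ->
  ballint (mpoly.mderiv i p) = (k + d).+1%:R * ballint (XU i * p).
Proof.
move=> hp; rewrite [p]mpoly.mpolyE raddf_sum /= mulr_sumr !ballint_sum mulr_sumr.
rewrite big_seq [RHS]big_seq; apply: eq_bigr => m /hp <-.
rewrite mpoly.mderivZ -scalerAr !ballintZ ballint_green_mon.
by rewrite mulrCA.
Qed.

Lemma mhom_mul k l p q : mhom k p -> mhom l q -> mhom (k + l) (p * q).
Proof.
move=> hp hq m /mpoly.msuppM_le /allpairsP [[m1 m2] /= [/hp <- /hq <- ->]].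
exact: mpoly.mdegD.
Qed.

Lemma mhom_deriv k p (i : 'I_d) : mhom k p -> mhom k.-1 (mpoly.mderiv i p).
Proof.
move=> hp m; rewrite mpoly.mcoeff_msupp mpoly.mcoeff_deriv => h.
have /hp : mpoly.mnm_add m (mpoly.mnm1 i) \in mpoly.msupp p.
  by rewrite mpoly.mcoeff_msupp; apply: contraNneq h => ->; rewrite mul0rn.
by rewrite mpoly.mdegD mpoly.mdeg1 addn1 => <-.
Qed.

Lemma euler_mhom k p : mhom k p ->
  \sum_(i < d) XU i * mpoly.mderiv i p = k%:R *: p.
Proof.
move=> hp; rewrite [in LHS](mpoly.mpolyE p) [in RHS](mpoly.mpolyE p) scaler_sumr.
under eq_bigr do rewrite raddf_sum mulr_sumr.
rewrite exchange_big /= big_seq [RHS]big_seq; apply: eq_bigr => m /hp <-.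
rewrite scalerA mulrC -scalerA; under eq_bigr do rewrite mpoly.mderivZ -scalerAr.
rewrite -scaler_sumr; congr (_ *: _).
rewrite mpoly.mdegE natr_sum scaler_suml; apply: eq_bigr => i _.
rewrite mpoly.mderivX -scalerAr; case: (posnP (m i)) => [->|mi]; first by rewrite !scale0r.
rewrite -mpoly.mpolyXD; congr (_ *: XM _); apply/mpoly.mnmP => j.
rewrite mpoly.mnmDE mpoly.mnmBE mpoly.mnm1E; case: eqP => [<-|_]; last by rewrite subn0.
by rewrite subnKC.
Qed.

(** Green's identity is applied to [p] times the [i]-th derivative of [q]. Summed over [i], the
    second derivatives form the Laplacian of [q] and disappear, while on the other side Euler's
    identity rebuilds [q]. *)
Lemma ballint_grad k l p q : mhom k p -> mhom l q ->
  \sum_(i < d) mpoly.mderiv i (mpoly.mderiv i q) = 0 ->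
  \sum_(i < d) ballint (mpoly.mderiv i p * mpoly.mderiv i q)
  = (k + l + d)%:R * (l%:R * ballint (p * q)).
Proof.
move=> hp hq lq.
have h i : ballint (mpoly.mderiv i (p * mpoly.mderiv i q))
    = (k + l + d)%:R * ballint (p * (XU i * mpoly.mderiv i q)).
  (* For [l = 0] the degree [l - 1] would be truncated and give a wrong factor; here the derivative
     of [q] is zero and both sides vanish. *)
  case: l hq {lq} => [|l] hq.
    have -> : mpoly.mderiv i q = 0.
      rewrite [q]mpoly.mpolyE raddf_sum /= big_seq big1// => m /hq m0.
      rewrite mpoly.mderivZ mpoly.mderivX.
      have -> : m i = 0%N.
        by apply/eqP; rewrite -leqn0 -m0 mpoly.mdegE (bigD1 i)//= leq_addr.
      by rewrite scale0r scaler0.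
    by rewrite !mulr0 mpoly.mderiv0 ballint0 mulr0.
  rewrite (@ballint_green _ _ i (mhom_mul hp (@mhom_deriv _ q i hq))).
  by rewrite /= addnS addSn mulrCA.
transitivity (\sum_(i < d) ballint (mpoly.mderiv i (p * mpoly.mderiv i q))).
  rewrite -!ballint_sum.
  under [in RHS]eq_bigr do rewrite mpoly.mderivM.
  by rewrite big_split/= -mulr_sumr lq mulr0 addr0.
under eq_bigr do rewrite h.
rewrite -mulr_sumr -ballint_sum -mulr_sumr (euler_mhom hq).
by rewrite -scalerAr ballintZ.
Qed.

Lemma ballint_harmonic k l p q : mhom k p -> mhom l q ->
  \sum_(i < d) mpoly.mderiv i (mpoly.mderiv i p) = 0 ->
  \sum_(i < d) mpoly.mderiv i (mpoly.mderiv i q) = 0 ->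
  k != l -> ballint (p * q) = 0.
Proof.
move=> hp hq lp lq kl.
have h1 := ballint_grad hp hq lq.
have := ballint_grad hq hp lp.
under eq_bigr do rewrite mulrC.
rewrite h1 [q * p]mulrC [(l + k)%N]addnC => /eqP.
have kl0 : (k + l + d)%:R != 0 :> R.
  by rewrite pnatr_eq0 -lt0n; case: k l kl {hp hq h1} => [|k] [|l].
rewrite (inj_eq (mulfI kl0)) -subr_eq0 -mulrBl mulf_eq0 => /orP[|/eqP//].
by rewrite subr_eq0 eqr_nat eq_sym (negbTE kl).
Qed.

Lemma row_of_scale (c : R) s : size s = d -> row_of [seq c * x | x <- s] = c *: row_of s.
Proof.
move=> sn; apply/rowP => i; rewrite !mxE (nth_map 0)// sn; exact: ltn_ord.
Qed.

Lemma enormZ (c : R) (x : 'rV[R]_d) : enorm (c *: x) = `|c| * enorm x.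
Proof.
rewrite /enorm -sqrtr_sqr -sqrtrM ?sqr_ge0// mulr_sumr; congr Num.sqrt.
by apply: eq_bigr => i _; rewrite mxE exprMn.
Qed.

Lemma row_of_eq0 s : enorm (row_of s) = 0 -> row_of s = 0.
Proof.
move=> h; apply/rowP => i; rewrite !mxE; apply/eqP.
by have := nth_le_enorm s i; rewrite h normr_le0.
Qed.

Lemma gsph_hom k g s : mhom k g -> gsph g s = (enorm (row_of s))^-1 ^+ k * peval g (row_of s).
Proof. exact: peval_hom. Qed.

(* Integrating [k r^(k-1)] times the ball of radius [r] over [0 <= r <= 1]
   gives [k/(k+d)] times the unit ball by scaling, and the weight [1-|x|^k]
   after exchanging the integrals. *)
Lemma sphL_ballint k g : (0 < d)%N -> (0 < k)%N -> mhom k g ->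
  k%:R / (k + d)%:R * sphL g = sphL g - ballint g.
Proof.
move=> d0 k0 hg.
pose w (r : R) : R := k%:R * r ^+ k.-1 * ((if 0 <= r then 1 else 0) * (if r <= 1 then 1 else 0)).
pose F (t : unit * RM) s : R := w t.2 * ((if enorm (row_of s) <= t.2 then 1 else 0) * gsph g s).
have wpos r : 0 <= r -> r <= 1 -> w r = k%:R * r ^+ k.-1 by move=> r0 r1; rewrite /w r0 r1 !mulr1.
have wout r : ~~ ((0 <= r) && (r <= 1)) -> w r = 0.
  by rewrite /w; case: (0 <= r) => /=; case: (r <= 1) => //=; rewrite ?mulr0 ?mul0r ?mulr0.
have mw : measurable_fun [set: R] w.
  apply: measurable_funM; first by apply: measurable_funM => //; exact: exprn_measurable.
  by apply: measurable_funM; apply: measurable_fun_ifT => //; exact: measurable_fun_ler.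
have M0 : 0 <= k%:R * pnorm g by rewrite mulr_ge0// pnorm_ge0.
have jF : jmeas d F.
  apply: jmeasM.
    apply: (@jmeas_par _ _ _ _ (fun t : unit * RM => w t.2)).
    by apply: measurableT_comp; [exact: mw|exact: measurable_snd].
  apply: jmeasM; last exact: jmeas_gsph.
  apply: jmeas_ler; first exact: jmeas_enorm.
  by apply: (@jmeas_par _ _ _ _ (fun t : unit * RM => t.2 : R)); exact: measurable_snd.
have bF : forall t r s, size s = d ->
    `|F (t, r) s| <= k%:R * pnorm g * (`|r| <= 1)%R%:R * cubeb s.
  move=> t r s sn; rewrite /F /=.
  case: (boolP ((0 <= r) && (r <= 1))) => [/andP[r0 r1]|h]; last first.
    by rewrite wout// mul0r normr0 !mulr_ge0// ?ler0n// pnorm_ge0.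
  rewrite (ger0_norm r0) r1 mulr1 wpos//; case: ifPn => h; last first.
    by rewrite mul0r mulr0 normr0 mulr_ge0// ler0n.
  rewrite (@sqn_cubeb _ d)//; last by rewrite -enorm_row_le1 (le_trans h r1).
  rewrite mulr1 mul1r normrM ler_pM// ?gsph_le// normrM normr_nat ler_piMr//.
  by rewrite normrX exprn_ile1// ger0_norm.
have sw := iint_swap tt M0 jF bF.
(* As [gsph g] is constant along rays, the ball of radius [r] contributes [r^d] times the unit
   ball. *)
have L1 r : iint d (F (tt, r)) = w r * r ^+ d * sphL g.
  case: (boolP ((0 <= r) && (r <= 1))) => [/andP[r0 r1]|h]; last first.
    by rewrite wout// !mul0r; apply: iint_eq0 => s sn; rewrite /F /= wout// mul0r.
  (* Scaling by the inverse of [r] requires [r > 0]. For [r = 0] only the origin remains, where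
     [gsph g] is 0 because [k > 0]. *)
  move: r0; rewrite le_eqVlt => /predU1P[<-|r0].
    rewrite expr0n eqn0Ngt d0 mulr0 mul0r; apply: iint_eq0 => s sn.
    rewrite /F /= (@gsph_hom k g s hg); case: ifPn => h; last by rewrite mul0r mulr0.
    have -> : enorm (row_of s) = 0 by apply/eqP; rewrite eq_le h enorm_row_ge0.
    by rewrite invr0 expr0n eqn0Ngt k0 mul0r !mulr0.
  have ri : 0 < r^-1 by rewrite invr_gt0.
  rewrite -mulrA.
  have -> : r ^+ d = r^-1 ^- d by rewrite -exprVn invrK.
  have := iint_scale tt (pnorm_ge0 g) ri (jmeas_sphp g) (cbounded_sphp (lexx _)).
  rewrite -[iint d (fun s => (if enorm (row_of s) <= 1 then 1 else 0) * gsph g s)]/(sphL g) => <-.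
  pose F2 (t : unit) s := (if enorm (row_of s) <= r then 1 else 0) * gsph g s.
  have jF2 : jmeas d F2.
    apply: jmeasM; last exact: jmeas_gsph.
    by apply: jmeas_ler; [exact: jmeas_enorm|exact: jmeas_par].
  have bF2 : cbounded d F2 (pnorm g).
    move=> t s sn; rewrite /F2; case: ifPn => h; last first.
      by rewrite mul0r normr0 mulr_ge0// ?pnorm_ge0// ler0n.
    rewrite (@sqn_cubeb _ d)//; last by rewrite -enorm_row_le1 (le_trans h r1).
    by rewrite mulr1 mul1r gsph_le.
  rewrite -[LHS]/(iint d (fun s => w r * F2 tt s)).
  rewrite (iintZ (w r) tt (pnorm_ge0 g) jF2 bF2); congr (_ * _).
  apply: eq_iint => s sn; rewrite /F2 /gsph row_of_scale// enormZ gtr0_norm//.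
  have -> : (r^-1 * enorm (row_of s) <= 1) = (enorm (row_of s) <= r).
    by rewrite mulrC ler_pdivrMr// mul1r.
  congr (_ * peval g _).
  rewrite invfM invrK scalerA; congr (_ *: _).
  by rewrite mulrAC divff ?mul1r// gt_eqF.
(* The weight [w] has integral [1 - |x|^k] over [[|x|, 1]], and [|x|^k] times [g(x/|x|)] is
   [g(x)]. *)
have L2 s : size s = d -> \int[mu]_r F (tt, r) s =
    (if enorm (row_of s) <= 1 then 1 else 0) * gsph g s
    + -1 * ((if enorm (row_of s) <= 1 then 1 else 0) * peval g (row_of s)).
  move=> sn; case: (leP (enorm (row_of s)) 1) => h; last first.
    rewrite !mul0r mulr0 addr0 (_ : (fun r => _) = fun=> 0).
      by rewrite Rintegral_cst// mul0r.
    apply/funext => r; rewrite /F /=; case: ifPn => h2; last by rewrite mul0r mulr0.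
    rewrite wout ?mul0r// negb_and -!ltNge (lt_le_trans h h2) orbT //.
  set e := enorm (row_of s) in h *.
  have e0 : 0 <= e by exact: enorm_row_ge0.
  transitivity (\int[mu]_(r in `[e, 1]) (('X^k)^`().[r] * gsph g s)).
    rewrite [RHS]Rintegral_mkcond; apply: eq_Rintegral => r _; rewrite patchE /F /= -/e.
    have -> : (r \in `[e, 1]%classic) = (e <= r) && (r <= 1).
      by apply/idP/idP; rewrite inE /= in_itv.
    rewrite derivXn hornerMn hornerXn -mulr_natl.
    case: (leP e r) => er /=; last by rewrite mul0r mulr0.
    rewrite mul1r; case: (leP r 1) => r1.
      by rewrite wpos// (le_trans e0 er).
    by rewrite wout ?mul0r// negb_and -!ltNge r1 orbT.
  rewrite RintegralZr//; last exact: integrable_poly.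
  rewrite Rintegral_deriv_poly// !hornerXn expr1n mulrBl !mul1r mulN1r; congr (_ - _).
  rewrite (@gsph_hom k g s hg) -/e.
  case: (eqVneq e 0) => [ez|enz].
    rewrite (row_of_eq0 ez) ez -[X in peval g X](scale0r 0) (peval_hom 0 0 hg).
    by rewrite expr0n eqn0Ngt k0 !mul0r.
  by rewrite mulrA -exprMn divff// expr1n mul1r.
have -> : k%:R / (k + d)%:R * sphL g = \int[mu]_r iint d (F (tt, r)).
  transitivity (\int[mu]_(r in `[0, 1]) (((k%:R / (k + d)%:R) *: 'X^(k + d))^`().[r] * sphL g)).
    rewrite RintegralZr//; last exact: integrable_poly.
    rewrite Rintegral_deriv_poly// !hornerE expr1n expr0n addn_eq0 !eqn0Ngt k0 /= mulr0 subr0.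
    by rewrite mulr1.
  rewrite Rintegral_mkcond; apply: eq_Rintegral => r _; rewrite patchE L1.
  have -> : (r \in `[0, 1]%classic) = (0 <= r) && (r <= 1).
    by apply/idP/idP; rewrite inE /= in_itv.
  case: (boolP ((0 <= r) && (r <= 1))) => [/andP[r0 r1]|h]; last by rewrite wout// !mul0r.
  rewrite derivZ derivXn hornerZ hornerMn hornerXn -[r ^+ (k + d).-1 *+ _]mulr_natl wpos//.
  have kd0 : (k + d)%:R != 0 :> R by rewrite pnatr_eq0 addn_eq0 !eqn0Ngt k0.
  rewrite mulrA divfK//; congr (_ * _).
  by rewrite -mulrA -exprD; congr (_ * _ ^+ _); rewrite -[in LHS](prednK k0).
rewrite sw.
have -> : iint d (fun s => \int[mu]_r F (tt, r) s) =
  iint d (fun s => (if enorm (row_of s) <= 1 then 1 else 0) * gsph g s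
    + -1 * ((if enorm (row_of s) <= 1 then 1 else 0) * peval g (row_of s))).
  exact: eq_iint.
rewrite (@iintD _ d _ _ (fun (_ : unit) s => (if enorm (row_of s) <= 1 then 1 else 0) * gsph g s)
  (fun (_ : unit) s => -1 * ((if enorm (row_of s) <= 1 then 1 else 0) * peval g (row_of s)))
      (pnorm g) tt).
- rewrite (iintZ (-1) tt (pnorm_ge0 g) (jmeas_ballp g) (cbounded_ballp (lexx _))).
  by rewrite mulN1r.
- exact: pnorm_ge0.
- exact: jmeas_sphp.
- exact: cbounded_sphp.
- by apply: jmeasM; [exact: jmeas_par|exact: jmeas_ballp].
- by move=> t s sn; rewrite mulN1r normrN; exact: (cbounded_ballp (lexx _) t).
Qed.

(** Since [d > 0], the ratio [k/(k+d)] differs from 1, so the relation of [sphL_ballint] forces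
    [sphL g] to vanish with [ballint g]. *)
Lemma sphL_eq0 k g : (0 < d)%N -> (0 < k)%N -> mhom k g -> ballint g = 0 -> sphL g = 0.
Proof.
move=> d0 k0 hg b0; have := sphL_ballint d0 k0 hg; rewrite b0 subr0 => /eqP.
have kd0 : (k + d)%:R != 0 :> R by rewrite pnatr_eq0 addn_eq0 !eqn0Ngt k0.
rewrite -[X in _ == X]mul1r -subr_eq0 -mulrBl mulf_eq0 => /orP[|/eqP//].
rewrite subr_eq0 -(inj_eq (mulIf kd0)) divfK// mul1r eqr_nat.
by rewrite -[X in X == _]addn0 eqn_add2l eq_sym eqn0Ngt d0.
Qed.

Lemma sphere_int_peval p : sphere_int (fun xi => peval p xi) = d%:R * sphL p.
Proof. by []. Qed.

Lemma sphere_intZ c p : sphere_int (fun xi => c * peval p xi) = c * sphere_int (fun xi => peval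
    p xi).
Proof.
rewrite /sphere_int mulrCA; congr (_ * _).
rewrite -[RHS](iintZ c tt (pnorm_ge0 p) (jmeas_sphp p) (cbounded_sphp (lexx _))).
by apply: eq_iint => s sn; rewrite mulrCA.
Qed.

Lemma homog_harmonic_mhom k p : homog_harmonic k p -> mhom k p.
Proof. by case=> /allP h _ m /h /eqP. Qed.

Lemma sphere_int_harmonic k l p q : (0 < d)%N -> homog_harmonic k p -> homog_harmonic l q ->
  k != l -> sphere_int (fun xi => peval p xi * peval q xi) = 0.
Proof.
move=> d0 hp hq kl.
have -> : (fun xi => peval p xi * peval q xi) = (fun xi => peval (p * q) xi).
  by apply/funext => x; rewrite pevalM.
have hp' := homog_harmonic_mhom hp; have hq' := homog_harmonic_mhom hq.
rewrite sphere_int_peval (@sphL_eq0 (k + l))// ?mulr0//.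
(* Distinct degrees cannot both be 0, so the product has positive degree, as [sphL_eq0] demands. *)
- by case: k l kl {hp hq hp' hq'} => [|k] [|l].
- exact: mhom_mul.
- by case: hp hq => _ lp [_ lq]; exact: (ballint_harmonic hp' hq').
Qed.

End sphere_and_ball.

(** * Polynomials against the weight [t^a] on []0, 1]], for [a > -1] *)

Section power_integral.
Context {R : realType}.
Local Notation mu := (@lebesgue_measure R).
Implicit Types (a b : R) (p q : {poly R}).

(** For negative [b] the integrand is singular at 0. The interval is exhausted by [[1/(n+2), 1]]:
    monotone convergence gives one limit, the fundamental theorem of calculus the other. *)
Lemma integral_powR01 b : -1 < b ->
  (\int[mu]_(t in `]0%R, 1%R]) (powR t b)%:E = ((b + 1)^-1)%:E)%E.
Proof.
move=> b1; have b0 : 0 < b + 1 by rewrite -ltrBlDr sub0r.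
pose e (n : nat) : R := n.+2%:R^-1.
have e0 n : 0 < e n by rewrite invr_gt0.
have e1 n : e n < 1 by rewrite invf_lt1// ltr1n.
pose E (n : nat) : set R := `[e n, 1]%classic.
have EU : \bigcup_n E n = `]0, 1]%classic.
  apply/seteqP; split => [t [n _]|t]; rewrite /E /= !in_itv/= => /andP[t0 t1].
    by rewrite t1 (lt_le_trans (e0 n) t0).
  have [n _ hn] := near_infty_natSinv_lt (PosNum t0).
  exists n => //=; rewrite in_itv/= t1 andbT ltW//; exact: (hn n.+1 (leqnSn n)).
have ndE : nondecreasing_seq E.
  move=> m n mn; apply/subsetPset => t; rewrite /E /= !in_itv/= => /andP[t0 ->].
  by rewrite andbT (le_trans _ t0)// /e lef_pV2 ?posrE// ler_nat !ltnS.
have c1 : (\int[mu]_(t in E i) (powR t b)%:E @[i --> \oo] --> \int[mu]_(t in `]0%R, 1%R]) (powR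
    t b)%:E)%E.
  rewrite -EU; apply: ge0_nondecreasing_set_cvg_integral => //.
  - by move=> n; exact: measurable_itv.
  - move=> n; apply/measurable_EFinP; apply: measurable_funTS; exact: measurable_powR.
  - by move=> n t _; rewrite lee_fin powR_ge0.
have fE n : (\int[mu]_(t in E n) (powR t b)%:E = ((b + 1)^-1 * (1 - powR (e n) (b + 1)))%:E)%E.
  rewrite (@continuous_FTC2 _ (fun t => powR t b) (fun t => (b + 1)^-1 * powR t (b + 1)))//.
  - by rewrite -EFinB powR1 mulrBr.
  - apply: derivable_within_continuous => t; rewrite in_itv/= => /andP[t0 _].
    by apply: derivable_powR; rewrite in_itv/= andbT (lt_le_trans (e0 n) t0).
  - have cF t : 0 < t -> derivable (fun t => (b + 1)^-1 * powR t (b + 1)) t 1.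
      by move=> t0; apply: derivableM => //; apply: derivable_powR; rewrite in_itv/= andbT.
    have cc t : 0 < t -> {for t, continuous (fun t => (b + 1)^-1 * powR t (b + 1))}.
      by move=> t0; apply: differentiable_continuous; apply/derivable1_diffP; exact: cF.
    split.
    + by move=> t; rewrite in_itv/= => /andP[t0 _]; apply: cF; exact: lt_trans t0.
    + by apply: cvg_at_right_filter; exact: (cc _ (e0 n)).
    + by apply: cvg_at_left_filter; exact: (cc _ ltr01).
  - move=> t; rewrite in_itv/= => /andP[t0 _].
    have tp : 0 < t by exact: lt_trans t0.
    have h : is_derive t 1 (fun t => (b + 1)^-1 * powR t (b + 1)) ((b + 1)^-1 * ((b + 1) * powR
        t (b + 1 - 1))).
      have := @is_deriveM R _ (cst (b + 1)^-1) (fun t => powR t (b + 1)) t 1 _ _ (is_derive_cst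
          _ _ _) (is_derive1_powR (b + 1) tp).
      by rewrite scaler0 addr0.
    by rewrite derive1E derive_val addrK mulrA mulVf ?mul1r// gt_eqF.
have c2 : (\int[mu]_(t in E i) (powR t b)%:E @[i --> \oo] --> ((b + 1)^-1)%:E)%E.
  rewrite (_ : (fun i => _) = (fun n => ((b + 1)^-1 * (1 - powR (e n) (b + 1)))%:E)); last first.
    by apply/funext => n; exact: fE.
  apply: cvg_EFin; first by near=> n.
  have ce : powR (e n) (b + 1) @[n --> \oo] --> (0 : R).
    have /cvg_at_rightP := @powR_cvg0 R (b + 1) b0; apply; split => //.
    by have := @cvg_harmonic R; rewrite -(cvg_shiftS (@harmonic R)).
  have := cvgM (cvg_cst (b + 1)^-1) (cvgB (cvg_cst (1 : R)) ce).
  by rewrite subr0 mulr1; exact.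
exact: (cvg_unique _ c1 c2).
Unshelve. all: by end_near. Qed.

Lemma integrable_powR01 b : -1 < b -> mu.-integrable `]0, 1] (fun t => (powR t b)%:E).
Proof.
move=> b1; apply/integrableP; split.
  by apply/measurable_EFinP; apply: measurable_funTS; exact: measurable_powR.
under eq_integral do rewrite gee0_abs ?lee_fin ?powR_ge0//.
by rewrite integral_powR01// ltry.
Qed.

Lemma integrable_poly_powR p a : -1 < a ->
  mu.-integrable `]0, 1] (fun t => (p.[t] * powR t a)%:E).
Proof.
(* The exponent stays general: in [p * 'X + c] the factor ['X] is absorbed into the weight, raising
   [a] by 1. *)
move=> a1; elim/poly_ind: p a a1 => [|p c IH] a a1.
  apply: (eq_integrable _ (cst 0%E)) => //; last exact: integrable0.
  by move=> t _; rewrite horner0 mul0r.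
have a2 : -1 < a + 1 by lra.
have : mu.-integrable `]0, 1] ((fun t : R => (p.[t] * powR t (a + 1))%:E) \+
    (fun t : R => c%:E * (powR t a)%:E))%E.
  apply: integrableD => //; first exact: IH.
  by apply: integrableZl => //; exact: integrable_powR01.
apply: eq_integrable => // t; rewrite inE/= in_itv/= => /andP[t0 t1].
rewrite -EFinM -EFinD !hornerE powRD; last by rewrite (gt_eqF t0) implybT.
by rewrite powRr1 ?ltW// mulrDl; congr (_ + _)%:E; ring.
Qed.

Lemma Rintegral_poly_powR p a : -1 < a ->
  \int[mu]_(t in `]0, 1]) (p.[t] * powR t a) = \sum_(i < size p) p`_i / (a + i%:R + 1).
Proof.
move=> a1.
have h (s : seq R) b : -1 < b ->
    \int[mu]_(t in `]0, 1]) ((Poly s).[t] * powR t b) = \sum_(i < size s) s`_i / (b + i%:R + 1).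
  elim: s b => [|c s IH] b b1.
    transitivity (\int[mu]_(t in `]0, 1]) (0 : R)).
      by apply: eq_Rintegral => t _; rewrite horner0 mul0r.
    by rewrite Rintegral_cst// mul0r big_ord0.
  have b2 : -1 < b + 1 by lra.
  transitivity (\int[mu]_(t in `]0, 1]) ((Poly s).[t] * powR t (b + 1) + c * powR t b)).
    apply: eq_Rintegral => t; rewrite inE/= in_itv/= => /andP[t0 t1].
    rewrite horner_cons powRD; last by rewrite (gt_eqF t0) implybT.
    by rewrite powRr1 ?ltW// mulrDl; congr (_ + _); ring.
  rewrite RintegralD//; last 2 first.
  - exact: integrable_poly_powR.
  - exact: (integrableZl _ c (integrable_powR01 b1)).
  rewrite RintegralZl//; last exact: integrable_powR01.
  rewrite IH// {1}/Rintegral integral_powR01//= big_ord_recl/= addr0 addrC; congr (_ + _).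
  apply: eq_bigr => i _; congr (_ / _); rewrite /= -natr1; ring.
by have := h p a a1; rewrite polyseqK.
Qed.

End power_integral.

(** * Jacobi polynomials with second parameter 0, in the variable [t = (1 - u)/2] *)

Section jacobi.
Context {R : realType}.
Local Notation mu := (@lebesgue_measure R).
Implicit Types (a b al : R) (p q : {poly R}).

Lemma pochD a k l : poch a (k + l) = poch a k * poch (a + k%:R) l.
Proof.
rewrite /poch big_split_ord/=; congr (_ * _); apply: eq_bigr => i _.
by rewrite natrD addrA.
Qed.

Lemma pochS a k : poch a k.+1 = poch a k * (a + k%:R).
Proof. by rewrite /poch big_ord_recr. Qed.

Lemma poch_opp n k : (k <= n)%N -> poch (- n%:R : R) k = (-1) ^+ k * ('C(n, k) * k`!)%:R.
Proof.
rewrite bin_ffact; elim: k => [|k IH] kn; first by rewrite /poch big_ord0 expr0 mul1r ffactn0.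
rewrite (pochS (- n%:R) k) (IH (ltnW kn)) ffactnSr natrM (natrB _ (ltnW kn)) exprS.
by ring.
Qed.

Definition fdiff (n : nat) (p : {poly R}) : R :=
  \sum_(k < n.+1) (-1) ^+ k * 'C(n, k)%:R * p.[k%:R].

(** Writing [p = q * 'X + c], the constant is killed by the binomial expansion of [(1 - 1)^(n+1)].
    The identity [k C(n+1, k) = (n+1) C(n, k-1)] turns the rest into an [n]-th difference of
    [q('X + 1)], of lower degree. *)
Lemma fdiff_eq0 n p : (size p <= n)%N -> fdiff n p = 0.
Proof.
elim: n p => [|n IH] p.
  rewrite leqn0 size_poly_eq0 => /eqP ->.
  by rewrite /fdiff big1// => k _; rewrite horner0 mulr0.
elim/poly_ind: p => [_|q c _ sp]; first by rewrite /fdiff big1// => k _; rewrite horner0 mulr0.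
have sq : (size q <= n)%N.
  move: sp; rewrite size_MXaddC; case: ifP => [/andP[/eqP -> _]|_]; rewrite ?size_poly0//.
transitivity (\sum_(k < n.+2) (-1) ^+ k * 'C(n.+1, k)%:R * (q.[k%:R] * k%:R)
   + c * \sum_(k < n.+2) (-1) ^+ k * 'C(n.+1, k)%:R).
  rewrite mulr_sumr -big_split/=; apply: eq_bigr => k _.
  by rewrite hornerD hornerM hornerX hornerC; ring.
have -> : \sum_(k < n.+2) (-1) ^+ k * 'C(n.+1, k)%:R = 0 :> R.
  transitivity ((1 - 1 : R) ^+ n.+1); last by rewrite subrr expr0n.
  rewrite exprDn; apply: eq_bigr => k _.
  by rewrite expr1n mul1r mulr_natr.
rewrite mulr0 addr0 big_ord_recl/= mulr0 mulr0 add0r.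
transitivity (- n.+1%:R * fdiff n (q \Po ('X + 1%:P))).
  rewrite /fdiff mulr_sumr; apply: eq_bigr => k _.
  rewrite horner_comp !hornerE /bump/= add1n natr1 exprS.
  have -> : 'C(n.+1, k.+1)%:R = n.+1%:R * 'C(n, k)%:R / k.+1%:R :> R.
    by rewrite -natrM (mul_bin_diag n.+1 k) natrM mulrC mulKf// pnatr_eq0.
  have : k.+1%:R != 0 :> R by rewrite pnatr_eq0.
  move: (k.+1%:R : R) (n.+1%:R : R) => K N K0.
  by field.
rewrite IH ?mulr0// size_comp_poly2//.
by rewrite -[1%:P]opprK -polyCN size_XsubC.
Qed.

(* The Jacobi polynomial P_n^(al,0) as a polynomial in [t = (1 - u) / 2]; its
   coefficients use [(al+k+1)_(n-k) (n+al+1)_k = (al+k+1)_n]. *)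
Definition jacT al (n : nat) : {poly R} :=
  \poly_(k < n.+1) ((-1) ^+ k * 'C(n, k)%:R * poch (al + k%:R + 1) n / n`!%:R).

Lemma jacobiP_jacT al n t : jacobiP al 0 n (1 - 2 * t) = (jacT al n).[t].
Proof.
rewrite /jacT horner_poly /jacobiP; apply: eq_bigr => k _.
have kn : (k <= n)%N by rewrite -ltnS.
have -> : (1 - (1 - 2 * t)) / 2 = t by field.
congr (_ * _).
rewrite poch_opp//.
have -> : poch (al + k%:R + 1) n = poch (al + k%:R + 1) (n - k) * poch (n%:R + al + 0 + 1) k.
  transitivity (poch (al + k%:R + 1) (n - k + k)); first by rewrite subnK.
  by rewrite pochD; congr (_ * poch _ _); rewrite natrB//; ring.
rewrite natrM; field.
by rewrite !pnatr_eq0 -!lt0n !fact_gt0.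
Qed.

(* Dividing [(al+k+1)_n] by its factor [al+k+1+j] leaves a polynomial in [k] of
   degree [n-1], which the [n]-th finite difference kills. *)
Lemma jacT_moment al n j : -1 < al -> (j < n)%N ->
  \sum_(k < n.+1) (jacT al n)`_k / (al + j%:R + k%:R + 1) = 0.
Proof.
move=> al1 jn; pose jo := Ordinal jn.
pose q : {poly R} := \prod_(i < n | i != jo) ('X + (al + 1 + i%:R)%:P).
have sq : (size q <= n)%N.
  apply: leq_trans (size_poly_prod_leq _ _) _.
  rewrite (eq_bigr (fun=> 2%N)); last by move=> i _; rewrite -[(al + _ + _)%:P]opprK -polyCN
      size_XsubC.
  rewrite sum_nat_const.
  have -> : #|(fun i : 'I_n => i != jo)| = n.-1.
    by rewrite cardC1 card_ord.
  lia.
transitivity (n`!%:R^-1 * fdiff n q); last by rewrite fdiff_eq0// mulr0.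
rewrite /fdiff mulr_sumr; apply: eq_bigr => k _.
rewrite coef_poly ltn_ord.
have k0 : (0 : R) <= k%:R by rewrite ler0n.
have j0 : (0 : R) <= j%:R by rewrite ler0n.
have nz : al + j%:R + k%:R + 1 != 0 by rewrite gt_eqF//; lra.
have -> : poch (al + k%:R + 1) n = (al + j%:R + k%:R + 1) * q.[k%:R].
  rewrite /poch (bigD1 jo)//= /q horner_prod; congr (_ * _); first by ring.
  by apply: eq_bigr => i _; rewrite hornerD hornerX hornerC; ring.
have : n`!%:R != 0 :> R by rewrite pnatr_eq0 -lt0n fact_gt0.
move: nz (n`!%:R : R); move: (al + _ + _ + _) => A A0 N N0.
by field; rewrite ?A0 ?N0.
Qed.

Lemma size_jacT al n : (size (jacT al n) <= n.+1)%N.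
Proof. exact: size_poly. Qed.

(** Multiplying by [t^j] shifts the weight to [t^(al+j)], so orthogonality to [t^j] is exactly
    [jacT_moment]; linearity does the rest. *)
Lemma jacT_orth al n q : -1 < al -> (size q <= n)%N ->
  \int[mu]_(t in `]0, 1]) ((jacT al n).[t] * q.[t] * powR t al) = 0.
Proof.
move=> al1 sq.
have h j : (j < n)%N -> \int[mu]_(t in `]0, 1]) ((jacT al n * 'X^j).[t] * powR t al) = 0.
  move=> jn; have alj : -1 < al + j%:R by rewrite (lt_le_trans al1)// lerDl ler0n.
  transitivity (\int[mu]_(t in `]0, 1]) ((jacT al n).[t] * powR t (al + j%:R))).
    apply: eq_Rintegral => t; rewrite inE/= in_itv/= => /andP[t0 t1].
    rewrite powRD; last by rewrite (gt_eqF t0) implybT.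
    by rewrite powR_mulrn ?ltW// hornerM hornerXn -!mulrA; congr (_ * _); rewrite mulrC.
  rewrite Rintegral_poly_powR// -[RHS](jacT_moment al1 jn).
  rewrite (big_ord_widen n.+1 (fun i => (jacT al n)`_i / (al + j%:R + i%:R + 1)) (size_jacT al
      n)).
  rewrite [RHS](bigID (fun i : 'I_n.+1 => (i < size (jacT al n))%N))/=.
  rewrite [X in _ = _ + X]big1 ?addr0// => i; rewrite -leqNgt => hi.
  by rewrite nth_default// mul0r.
have h2 (r : seq nat) : all (fun j => j < n)%N r ->
    \int[mu]_(t in `]0, 1]) ((jacT al n * \sum_(j <- r) q`_j *: 'X^j).[t] * powR t al) = 0.
  elim: r => [_|j r IH /= /andP[jn rn]].
    transitivity (\int[mu]_(t in `]0, 1]) (0 : R)).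
      by apply: eq_Rintegral => t _; rewrite big_nil mulr0 horner0 mul0r.
    by rewrite Rintegral_cst// mul0r.
  transitivity (\int[mu]_(t in `]0, 1]) (q`_j * ((jacT al n * 'X^j).[t] * powR t al)
      + (jacT al n * \sum_(j <- r) q`_j *: 'X^j).[t] * powR t al)).
    apply: eq_Rintegral => t _; rewrite big_cons mulrDr hornerD mulrDl; congr (_ + _).
    by rewrite -scalerAr hornerZ mulrA.
  rewrite RintegralD//; last 2 first.
  - exact: (integrableZl _ q`_j (integrable_poly_powR _ al1)).
  - exact: integrable_poly_powR.
  rewrite RintegralZl//; last exact: integrable_poly_powR.
  by rewrite h// mulr0 add0r IH.
have qE : q = \sum_(j <- iota 0 (size q)) q`_j *: 'X^j.
  by rewrite -[in LHS](coefK q) poly_def -(big_mkord xpredT (fun j => q`_j *: 'X^j))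
      /index_iota subn0.
have hq : all (fun j => j < n)%N (iota 0 (size q)).
  by apply/allP => j; rewrite mem_iota add0n /= => /leq_trans; exact.
rewrite -[RHS](h2 _ hq) -qE.
by apply: eq_Rintegral => t _; rewrite hornerM.
Qed.

End jacobi.

(** * The functions [jacJ] as polynomials with prescribed Taylor data at -1 *)

Section sobolev_jacobi.
Context {R : realType}.
Local Notation mu := (@lebesgue_measure R).
Implicit Types (a b al : R) (p q Q : {poly R}).

Lemma poly_antiderivative q a : exists Q, Q^`() = q /\ Q.[a] = 0.
Proof.
pose P : {poly R} := \poly_(i < (size q).+1) (q`_i.-1 / i%:R).
exists (P - P.[a]%:P); split; last by rewrite !hornerE subrr.
rewrite derivB derivC subr0; apply/polyP => i.
rewrite coef_deriv coef_poly ltnS; case: ltnP => iq; last by rewrite mul0rn nth_default.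
by rewrite -[LHS]mulr_natr divfK// pnatr_eq0.
Qed.

Lemma poly_antiderivn q a s : exists Q, Q^`(s) = q /\ forall k, (k < s)%N -> Q^`(k).[a] = 0.
Proof.
elim: s => [|s [Q [Qs Q0]]]; first by exists q.
have [P [PQ Pa]] := poly_antiderivative Q a.
exists P; split; first by rewrite derivSn PQ.
by case=> [|k] ks; [rewrite derivn0|rewrite derivSn PQ Q0].
Qed.

(* As a function of [X], the Taylor polynomial of [Q] at [X] evaluated at [u]:
   its derivative is the integrand of the integral remainder. *)
Definition taylor_rem (Q : {poly R}) (u : R) (s : nat) : {poly R} :=
  \sum_(i < s) (i`!%:R)^-1 *: ((u%:P - 'X) ^+ i * Q^`(i)).

Lemma inv_factMn n : (n.+1)`!%:R^-1 *+ n.+1 = n`!%:R^-1 :> R.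
Proof. by rewrite -[LHS]mulr_natr factS natrM invfM mulrAC mulVf ?mul1r// pnatr_eq0. Qed.

Lemma deriv_taylor_rem Q u s :
  (taylor_rem Q u s.+1)^`() = (s`!%:R)^-1 *: ((u%:P - 'X) ^+ s * Q^`(s.+1)).
Proof.
elim: s => [|s IH].
  by rewrite /taylor_rem big_ord1 fact0 invr1 !scale1r !expr0 !mul1r derivn0 derivn1.
rewrite /taylor_rem big_ord_recr/= -/(taylor_rem Q u s.+1) derivD IH derivZ derivM.
rewrite deriv_exp derivB derivC derivX sub0r /= mulN1r -derivnS scalerDr addrA.
rewrite -[RHS]add0r; congr (_ + _).
by rewrite mulrnAl mulNr -scalerMnr scalerMnl inv_factMn scalerN subrr.
Qed.

Lemma derivn_taylor_basis n k :
  ((n`!%:R)^-1 *: ('X + 1) ^+ n : {poly R})^`(k).[-1] = (n == k)%:R.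
Proof.
have dX1 : ('X + 1 : {poly R})^`() = 1 by rewrite derivD derivX -[1 in LHS]/(1%:P) derivC addr0.
elim: k n => [|k IH] [|n].
- by rewrite derivn0 expr0 fact0 invr1 scale1r hornerC.
- by rewrite derivn0 !hornerE addNr exprS mul0r mulr0.
- by rewrite expr0 derivSn derivZ -polyC1 derivC scaler0 derivn_poly0 ?size_poly0// horner0.
rewrite derivSn derivZ deriv_exp dX1 mul1r /= eqSS -IH; congr (_^`(k).[_]).
by rewrite -scalerMnr scalerMnl inv_factMn.
Qed.

Lemma jacobiPhat_poly al n : exists q, forall t u,
  jacobiPhat al 0 n u = q.[u] /\ jacobiPhat al 0 n (1 - 2 * t) = (jacA al 0 n *: jacT al n).[t].
Proof.
exists (jacA al 0 n *: (jacT al n \Po (2^-1 *: (1 - 'X)))) => t u; split; last first.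
  by rewrite /jacobiPhat jacobiP_jacT hornerZ.
rewrite /jacobiPhat hornerZ horner_comp; congr (_ * _).
have -> : (2^-1 *: (1 - 'X)).[u] = (1 - u) / 2.
  by rewrite hornerZ hornerD hornerN hornerX -polyC1 hornerC mulrC.
by rewrite -jacobiP_jacT; congr jacobiP; field.
Qed.

(** Both orientations matter: the boundary terms differentiate [jacJ] at -1, hence use its values on
    both sides of that point. *)
Lemma oint_deriv_poly a b p : oint a b (fun w => p^`().[w]) = p.[b] - p.[a].
Proof.
rewrite /oint; case: (leP a b) => ab; first by rewrite Rintegral_deriv_poly.
by rewrite Rintegral_deriv_poly ?ltW// opprB.
Qed.

(** For [n >= s] the defining integral is the Taylor remainder at -1 of an [s]-fold primitive [Q]
    whose Taylor polynomial of order below [s] is zero. The third claim then reads 0, since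
    [k < s <= n], so both branches share one Kronecker form. *)
Lemma jacJ_poly al s n : (0 < s)%N -> exists Q,
  [/\ forall u, jacJ al s n u = Q.[u],
      forall t, Q^`(s).[1 - 2 * t] =
        (if (n < s)%N then 0 else jacobiPhat (al + s%:R) 0 (n - s) (1 - 2 * t)) &
      forall k, (k < s)%N -> Q^`(k).[-1] = (n == k)%:R].
Proof.
move=> s0; rewrite /jacJ; case: ltnP => ns.
  exists ((n`!%:R)^-1 *: ('X + 1) ^+ n); split.
  - by move=> u; rewrite !hornerE mulrC.
  - move=> t; rewrite derivnZ derivn_poly0 ?scaler0 ?horner0//.
    apply: leq_trans (size_poly_exp_leq _ _) _.
    by rewrite -polyC1 size_XaddC mul1n.
  - by move=> k _; exact: derivn_taylor_basis.
have [q hq] := jacobiPhat_poly (al + s%:R) (n - s).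
have [Q [Qs Q0]] := poly_antiderivn q (-1) s.
exists Q; split.
- move=> u; case: s s0 ns hq Qs Q0 => // s _ ns hq Qs Q0.
  rewrite -[RHS]subr0.
  (* At ['X = u] only the term [i = 0] survives; at ['X = -1] every term vanishes by the choice of
     [Q]. *)
  have -> : Q.[u] = (taylor_rem Q u s.+1).[u].
    rewrite /taylor_rem big_ord_recl/= fact0 invr1 scale1r expr0 mul1r ?derivn0 hornerD
        horner_sum big1 ?addr0//.
    by move=> i _; rewrite hornerZ hornerM horner_exp hornerD hornerN hornerX hornerC subrr
        /bump leq0n add1n exprS !mul0r mulr0.
  have {2}-> : 0 = (taylor_rem Q u s.+1).[-1].
    by rewrite /taylor_rem horner_sum big1// => i _; rewrite hornerZ hornerM (Q0 i (ltn_ord i))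
        !mulr0.
  rewrite -oint_deriv_poly; congr oint; apply/funext => w.
  rewrite deriv_taylor_rem Qs (hq 0 w).1 hornerZ hornerM horner_exp hornerD hornerN hornerX
      hornerC /= mulrA.
  by congr (_ * _); exact: mulrC.
- by move=> t; rewrite Qs (hq t (1 - 2 * t)).1.
- by move=> k ks; rewrite Q0//; case: eqP ks => // <-; rewrite ltnNge ns.
Qed.

Lemma derive1n_horner p k : derive1n k (horner p) = horner p^`(k).
Proof.
by elim: k => [//|k IH]; rewrite derive1nS IH derivnS derivE.
Qed.

Lemma derivn_comp_affine p k :
  (p \Po (1 - 2 *: 'X))^`(k) = (-2) ^+ k *: (p^`(k) \Po (1 - 2 *: 'X)).
Proof.
elim: k => [|k IH]; first by rewrite scale1r !derivn0.
rewrite !derivnS IH derivZ deriv_comp derivB derivZ derivX.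
have -> : (1 : {poly R})^`() = 0 by rewrite -[1]/(1%:P) derivC.
by rewrite sub0r mulrN -scalerAr mulr1 scalerN scalerA exprSr mulrN scaleNr.
Qed.

End sobolev_jacobi.

(** * Radial orthogonality and separation of variables in the inner product *)

Section sobolev_orthogonality.
Context {R : realType}.
Local Notation mu := (@lebesgue_measure R).

Lemma Rintegral_jacobiPhat_orth (al : R) i j : -1 < al -> i != j ->
  \int[mu]_(t in `]0, 1])
    (jacobiPhat al 0 i (1 - 2 * t) * jacobiPhat al 0 j (1 - 2 * t) * powR t al) = 0.
Proof.
move=> al1; wlog ji : i j / (j < i)%N => [W ij|_].
  have [h|h|h] := ltngtP j i.
  - exact: W.
  - by rewrite -[RHS](W j i h); [apply: eq_Rintegral => t _; congr (_ * _); rewrite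
      mulrC|rewrite eq_sym].
  - by rewrite h eqxx in ij.
rewrite -[RHS](@jacT_orth _ al i ((jacA al 0 i * jacA al 0 j) *: jacT al j))//.
  apply: eq_Rintegral => t _; congr (_ * _).
  by rewrite /jacobiPhat !jacobiP_jacT hornerZ; ring.
by apply: leq_trans (size_scale_leq _ _) _; exact: leq_trans (size_jacT _ _) ji.
Qed.

(** Under [u = 1 - 2t] the differential gives 2 and [(1-u)^al] gives [2^al t^al]. *)
Lemma jac_hhat_sub (al : R) i :
  jac_hhat al 0 i = powR 2 (al + 1) *
    \int[mu]_(t in `]0, 1]) (jacobiPhat al 0 i (1 - 2 * t) ^+ 2 * powR t al).
Proof.
have [q hq] := jacobiPhat_poly al i.
have mf : measurable_fun [set: R] (fun u : R => q.[u] ^+ 2 * powR (1 - u) al * powR (1 + u) 0).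
  have mq : measurable_fun [set: R] (horner q).
    by apply: continuous_measurable_fun; exact: continuous_horner.
  apply: measurable_funM; first apply: measurable_funM.
  - exact: measurable_funX.
  - apply: (measurableT_comp (measurable_powR al)).
    exact: measurable_funB.
  - apply: (measurableT_comp (measurable_powR 0)).
    exact: measurable_funD.
have mg : measurable_fun [set: R] (fun t : R => q.[1 - 2 * t] ^+ 2 * powR t al).
  apply: measurable_funM; last exact: measurable_powR.
  apply: measurable_funX.
  apply: (measurableT_comp (_ : measurable_fun [set: R] (horner q))).
    by apply: continuous_measurable_fun; exact: continuous_horner.
  by apply: measurable_funB => //; exact: measurable_funM.
have n20 : (-2 : R) != 0 by rewrite oppr_eq0 pnatr_eq0.
transitivity (fine (\int[mu]_(u in `[(-1)%R, 1%R]) (q.[u] ^+ 2 * powR (1 - u) al * powR (1 + u)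
    0)%:E)%E).
  by congr fine; apply: eq_integral => u _; rewrite (hq 0 u).1.
rewrite (@ge0_integral_affine _ (-2) 1)//; last 2 first.
- by apply/measurable_EFinP; exact: measurable_funTS.
- by move=> u _; rewrite lee_fin (mulr_ge0 (mulr_ge0 (sqr_ge0 _) (powR_ge0 _ _)) (powR_ge0 _ _)).
have -> : (fun x : R => -2 * x + 1) @^-1` `[-1, 1] = `[0, 1]%classic.
  by apply/seteqP; split => t /=; rewrite !in_itv/= => /andP[h1 h2]; apply/andP; split; lra.
transitivity (fine (`|-2|%:E * (powR 2 al)%:E * \int[mu]_(t in `[0%R, 1%R]) (q.[1 - 2 * t] ^+ 2
    * powR t al)%:E)%E).
  congr fine; rewrite -muleA; congr (_ * _)%E.
  rewrite -ge0_integralZl//; last 2 first.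
  - by apply/measurable_EFinP; exact: measurable_funTS.
  - by move=> t _; rewrite lee_fin mulr_ge0 ?powR_ge0 ?sqr_ge0.
  apply: eq_integral => t; rewrite inE/= in_itv/= => /andP[t0 t1].
  rewrite -EFinM; congr EFin.
  have -> : -2 * t + 1 = 1 - 2 * t by ring.
  have -> : 1 - (1 - 2 * t) = 2 * t by ring.
  by rewrite powRr0 mulr1 powRM//; ring.
rewrite -integral_itv_obnd_cbnd; last first.
  by apply/measurable_EFinP; exact: measurable_funTS.
rewrite -EFinM (_ : `|-2| * powR 2 al = powR 2 (al + 1)); last first.
  rewrite normrN ger0_norm// powRD; last by rewrite pnatr_eq0 implybT.
  by rewrite powRr1// mulrC.
transitivity (powR 2 (al + 1) * \int[mu]_(t in `]0, 1]) (q.[1 - 2 * t] ^+ 2 * powR t al)).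
  (* An infinite [I] is sent to 0 by [fine] on both sides, so the identity holds for every [al]. *)
  rewrite /Rintegral.
  set I := (\int[mu]_(t in `]0%R, 1%R]) _)%E.
  have : (0 <= I)%E by apply: integral_ge0 => t _; rewrite lee_fin mulr_ge0 ?powR_ge0 ?sqr_ge0.
  case: I => [r _|_|//]; first by rewrite -EFinM.
  by rewrite gt0_muley ?lte_fin ?powR_gt0//= mulr0.
by congr (_ * _); apply: eq_Rintegral => t _; rewrite (hq 0 (1 - 2 * t)).1.
Qed.

(** At [t = 0] the function [powR] has a conventional value and the exponents need not add up, so
    [f] is described for [t > 0] only; the endpoint is a null set. *)
Lemma Rintegral01_poly_powR (f : R -> R) (p : {poly R}) (al : R) : -1 < al ->
  (forall t, 0 < t -> f t = p.[t] * powR t al) ->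
  \int[mu]_(t in `[0, 1]) f t = \int[mu]_(t in `]0, 1]) (p.[t] * powR t al).
Proof.
move=> al1 fE; rewrite -Rintegral_itv_obnd_cbnd.
  by apply: eq_Rintegral => t; rewrite inE/= in_itv/= => /andP[t0 _]; exact: fE.
have := integrable_poly_powR p al1; apply: eq_integrable => // t.
by rewrite inE/= in_itv/= => /andP[t0 _]; rewrite /= fE.
Qed.

Lemma dtn_sobS (d : nat) (Y : nat -> nat -> mpoly.mpoly d R) (beta : R) s n m l
    (Q : {poly R}) k (x : 'rV[R]_d) (t : R) :
  (forall u, jacJ (2 * m%:R + beta + d%:R - 1) s (n - m) u = Q.[u]) ->
  dtn k (sobS Y beta s n m l) x t = (-2) ^+ k * Q^`(k).[1 - 2 * t] * peval (Y m l) x.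
Proof.
move=> hQ; rewrite /dtn.
have -> : sobS Y beta s n m l x = horner (peval (Y m l) x *: (Q \Po (1 - 2 *: 'X))).
  apply/funext => u; rewrite /sobS hQ hornerZ horner_comp mulrC.
  by rewrite hornerD hornerN hornerZ hornerX -polyC1 hornerC.
rewrite derive1n_horner derivnZ hornerZ derivn_comp_affine hornerZ horner_comp mulrC.
by rewrite hornerD hornerN hornerZ hornerX -polyC1 hornerC.
Qed.

Lemma sob_ip_sobS (d : nat) (Y : nat -> nat -> mpoly.mpoly d R) (beta : R) s
    (lam : nat -> R) n m l n' m' l' (Q Q' : {poly R}) :
  (forall u, jacJ (2 * m%:R + beta + d%:R - 1) s (n - m) u = Q.[u]) ->
  (forall u, jacJ (2 * m'%:R + beta + d%:R - 1) s (n' - m') u = Q'.[u]) ->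
  mhom m (Y m l) -> mhom m' (Y m' l') ->
  let S := sphere_int (fun xi => peval (Y m l) xi * peval (Y m' l') xi) in
  sob_ip beta s lam (sobS Y beta s n m l) (sobS Y beta s n' m' l') =
  (omega R d)^-1 * \int[mu]_(t in `[0, 1])
    (t ^+ d.-1 * (((-2) ^+ s * Q^`(s).[1 - 2 * t] * t ^+ m) *
      ((-2) ^+ s * Q'^`(s).[1 - 2 * t] * t ^+ m') * powR t (beta + s%:R) * S))
  + \sum_(k < s) lam k / omega R d *
      (((-2) ^+ k * Q^`(k).[-1]) * ((-2) ^+ k * Q'^`(k).[-1]) * S).
Proof.
move=> hQ hQ' hY hY' S.
have hS c : sphere_int (fun xi => c * (peval (Y m l) xi * peval (Y m' l') xi)) = c * S.
  rewrite /S.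
  have -> : (fun xi => peval (Y m l) xi * peval (Y m' l') xi) =
      (fun xi => peval (Y m l * Y m' l') xi).
    by apply/funext => xi; rewrite pevalM.
  rewrite -sphere_intZ.
  by congr sphere_int; apply/funext => xi; rewrite pevalM.
rewrite /sob_ip; congr (_ * _ + _).
  rewrite /cone_int; apply: eq_Rintegral => t _; congr (_ * _).
  rewrite -hS; congr sphere_int; apply/funext => xi.
  rewrite (@dtn_sobS d Y beta s n m l Q _ _ _ hQ) (@dtn_sobS d Y beta s n' m' l' Q' _ _ _ hQ')
      (@peval_hom _ _ m (Y m l) _ _ hY) (@peval_hom _ _ m' (Y m' l') _ _ hY').
  by ring.
apply: eq_bigr => k _; congr (_ * _); rewrite -hS; congr sphere_int; apply/funext => xi.
rewrite (@dtn_sobS d Y beta s n m l Q _ _ _ hQ) (@dtn_sobS d Y beta s n' m' l' Q' _ _ _ hQ').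
(* The boundary [t = 1] is the point [u = -1] where the Taylor data of [jacJ] are known. *)
have -> : 1 - 2 * 1 = -1 :> R by ring.
by ring.
Qed.

End sobolev_orthogonality.

Theorem mainTheorem2 (R : realType) (d s : nat) (beta : R) (lam : nat -> R)
    (N : nat -> nat) (Y : nat -> nat -> mpoly.mpoly d R) :
  (2 <= d)%N -> (1 <= s)%N -> - d%:R - s%:R < beta ->
  (forall k, (k < s)%N -> 0 < lam k) ->
  sph_harm_ONB N Y ->
  (forall n m l n' m' l',
     (m <= n)%N -> (1 <= l <= N m)%N -> (m' <= n')%N -> (1 <= l' <= N m')%N ->
     (n, m, l) != (n', m', l') ->
     sob_ip beta s lam (sobS Y beta s n m l) (sobS Y beta s n' m' l') = 0) /\
  (forall n m l, (m <= n)%N -> (1 <= l <= N m)%N ->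
     sob_ip beta s lam (sobS Y beta s n m l) (sobS Y beta s n m l)
     = sob_h d beta s lam m n).
Proof.
move=> d2 s1 hb _ onb.
have d0 : (0 < d)%N by exact: leq_trans d2.
have harm m l : (1 <= l <= N m)%N -> homog_harmonic m (Y m l) by exact: (onb m).1.
pose w := (omega R d)^-1.
have m2 k : (-2) ^+ k * (-2) ^+ k = 2 ^+ (2 * k) :> R.
  by rewrite -exprMn mulrNN exprM expr2.
(* Equal [m], arbitrary [n], [n'], [l], [l']: one formula serves for orthogonality and for the norm.
   Its first summand is the cone integral, its second the boundary sum. *)
have gen n m l n' l' : (m <= n)%N -> (1 <= l <= N m)%N -> (m <= n')%N -> (1 <= l' <= N m)%N ->
    sob_ip beta s lam (sobS Y beta s n m l) (sobS Y beta s n' m l') =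
    (l == l')%:R *
    ((if (n - m < s)%N || (n' - m < s)%N then 0 else
       2 ^+ (2 * s) * \int[@lebesgue_measure R]_(t in `]0, 1])
        (jacobiPhat (s%:R + 2 * m%:R + beta + d%:R - 1) 0 (n - m - s) (1 - 2 * t) *
         jacobiPhat (s%:R + 2 * m%:R + beta + d%:R - 1) 0 (n' - m - s) (1 - 2 * t) *
         powR t (s%:R + 2 * m%:R + beta + d%:R - 1)))
     + (if (n == n') && (n - m < s)%N then 2 ^+ (2 * (n - m)) * lam (n - m)%N else 0)).
  move=> mn hl mn' hl'.
  set al := s%:R + 2 * m%:R + beta + d%:R - 1.
  have al1 : -1 < al.
    have : (0 : R) <= m%:R by rewrite ler0n.
    by rewrite /al; lra.
  have eal : 2 * m%:R + beta + d%:R - 1 + s%:R = al by rewrite /al; ring.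
  have [Q [Q1 Q2 Q3]] := jacJ_poly (2 * m%:R + beta + d%:R - 1) (n - m) s1.
  have [Q' [Q1' Q2' Q3']] := jacJ_poly (2 * m%:R + beta + d%:R - 1) (n' - m) s1.
  have hm := homog_harmonic_mhom (harm _ _ hl).
  have hm' := homog_harmonic_mhom (harm _ _ hl').
  have /= := sob_ip_sobS lam Q1 Q1' hm hm'.
  set S := sphere_int _.
  (* The normalisation by [omega] is absorbed here: each term contains it together with [S]. *)
  have wS : w * S = (l == l')%:R by exact: (onb m).2.1.
  move=> ->; rewrite mulrDr; congr (_ + _).
    rewrite eal in Q2 Q2'.
    pose P : {poly R} := S *: (((-2) ^+ s *: (Q^`(s) \Po (1 - 2 *: 'X))) * ((-2) ^+ s *:
        (Q'^`(s) \Po (1 - 2 *: 'X)))).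
    have PE t : P.[t] = S * (2 ^+ (2 * s) * (Q^`(s).[1 - 2 * t] * Q'^`(s).[1 - 2 * t])).
      rewrite hornerZ hornerM !hornerZ !horner_comp hornerD hornerN hornerZ hornerX -polyC1
          hornerC.
      by rewrite -m2; ring.
    rewrite (@Rintegral01_poly_powR _ _ P al al1); last first.
      move=> t t0; rewrite PE.
      have -> : powR t al = t ^+ d.-1 * t ^+ m * t ^+ m * powR t (beta + s%:R).
        have -> : al = d.-1%:R + m%:R + m%:R + (beta + s%:R).
          by rewrite /al -[in d%:R](prednK d0) -natr1; ring.
        rewrite !powRD ?(gt_eqF t0) ?implybT// !powR_mulrn//; exact: ltW.
      by rewrite -m2; ring.
    have intP := integrable_poly_powR (((-2) ^+ s *: (Q^`(s) \Po (1 - 2 *: 'X))) * ((-2) ^+ s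
        *: (Q'^`(s) \Po (1 - 2 *: 'X)))) al1.
    rewrite (_ : \int[_]_(t in _) _ = S * \int[@lebesgue_measure R]_(t in `]0, 1])
      ((((-2) ^+ s *: (Q^`(s) \Po (1 - 2 *: 'X))) * ((-2) ^+ s *: (Q'^`(s) \Po (1 - 2 *:
          'X)))).[t] * powR t al)); last first.
      rewrite -RintegralZl//; apply: eq_Rintegral => t _.
      by rewrite /P hornerZ mulrA.
    rewrite mulrA -/w wS; congr (_ * _).
    case: ifPn => [/orP h|].
      transitivity (\int[@lebesgue_measure R]_(t in `]0, 1]) (0 : R)).
        apply: eq_Rintegral => t _; rewrite hornerM !hornerZ !horner_comp hornerD hornerN
            hornerZ hornerX -polyC1 hornerC Q2 Q2'.
        by case: h => ->; rewrite ?mulr0 ?mul0r ?mulr0 ?mul0r.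
      by rewrite Rintegral_cst// mul0r.
    rewrite negb_or -!leqNgt => /andP[h h'].
    have [q hq] := jacobiPhat_poly al (n - m - s).
    have [q' hq'] := jacobiPhat_poly al (n' - m - s).
    rewrite -RintegralZl//; last first.
      have := integrable_poly_powR ((jacA al 0 (n - m - s) *: jacT al (n - m - s)) * (jacA al 0
          (n' - m - s) *: jacT al (n' - m - s))) al1.
      apply: eq_integrable => // t _; rewrite hornerM /= -(hq t 0).2 -(hq' t 0).2 //.
    apply: eq_Rintegral => t _.
    rewrite hornerM !hornerZ !horner_comp hornerD hornerN hornerZ hornerX -polyC1 hornerC Q2 Q2'.
    rewrite ltnNge h ltnNge h' /=.
    by rewrite -m2; ring.
  have Bk (k : 'I_s) : lam k / omega R d * ((-2) ^+ k * Q^`(k).[-1] * ((-2) ^+ k *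
      Q'^`(k).[-1]) * S) =
      (l == l')%:R * (((n - m)%N == k)%:R * ((n' - m)%N == k)%:R * (2 ^+ (2 * k) * lam k)).
    rewrite Q3// Q3'// -wS /w.
    by rewrite -m2; ring.
  rewrite (eq_bigr _ (fun k _ => Bk k)) -mulr_sumr; congr (_ * _).
  (* A boundary term is nonzero only when [n - m] and [n' - m] both equal [k], so at most one index
     contributes. *)
  case: ifPn => [/andP[/eqP <- h]|h].
    rewrite (bigD1 (Ordinal h))//= eqxx !mul1r big1 ?addr0// => k.
    by rewrite -val_eqE/= eq_sym => /negbTE ->; rewrite !mul0r.
  apply: big1 => k _; case: eqP => [e1|]; last by rewrite !mul0r.
  case: eqP => [e2|]; last by rewrite mulr0 mul0r.
  move: h; rewrite e1 ltn_ord andbT => /eqP; case.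
  by rewrite -(subnK mn) -(subnK mn') e1 e2.
split.
  move=> n m l n' m' l' mn hl mn' hl' neq.
  (* For different degrees [m], [m'] the spherical factor [S] is 0 and kills every term. *)
  have [em|nm] := eqVneq m m'; last first.
    have [Q [Q1 _ _]] := jacJ_poly (2 * m%:R + beta + d%:R - 1) (n - m) s1.
    have [Q' [Q1' _ _]] := jacJ_poly (2 * m'%:R + beta + d%:R - 1) (n' - m') s1.
    have /= -> := sob_ip_sobS lam Q1 Q1' (homog_harmonic_mhom (harm _ _ hl))
        (homog_harmonic_mhom (harm _ _ hl')).
    rewrite (sphere_int_harmonic d0 (harm _ _ hl) (harm _ _ hl') nm).
    rewrite big1 ?addr0; last by move=> k _; rewrite !mulr0.
    rewrite (_ : (fun t => _) = fun=> 0); first by rewrite Rintegral_cst// mul0r mulr0.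
    by apply/funext => t; rewrite !mulr0.
  subst m'; rewrite gen//.
  have [el|nl] := eqVneq l l'; last by rewrite mul0r.
  subst l'; rewrite mul1r.
  have nn : n != n' by apply: contraNneq neq => ->.
  rewrite (negbTE nn) /= addr0; case: ifPn => //; rewrite negb_or -!leqNgt => /andP[h h'].
  rewrite Rintegral_jacobiPhat_orth ?mulr0//.
    have : (0 : R) <= m%:R by rewrite ler0n.
    lra.
  (* The truncated subtractions are exact, as [m <= n] and [s <= n - m] (likewise for [n']), so
     distinct [n], [n'] give distinct Jacobi degrees. *)
  apply: contra nn => /eqP e; apply/eqP.
  by rewrite -(subnK mn) -(subnK mn') -(subnK h) -(subnK h') e.
move=> n m l mn hl; rewrite (gen n m l n l mn hl mn hl) !eqxx andTb mul1r orbb /sob_h.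
case: (boolP (n - m < s)%N) => h; first exact: add0r.
rewrite [LHS]addr0 jac_hhat_sub [RHS]mulrA; congr (_ * _).
  (* The exponents match: [2s = (s - beta - 2m - d) + (al + 1)]. *)
  rewrite -powR_mulrn// -powRD; last by rewrite pnatr_eq0 implybT.
  by congr powR; rewrite natrM; ring.
Qed.
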